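(* Let $B,\Delta B\in\mathbb{C}^{m\times n}$ with $m\ge n$, and let $B(t)=B+t\,\Delta B$ for $t\in\mathbb{R}$. Let $r_1,\dots,r_k$ be positive integers with $r_1+\cdots+r_k=n$. Suppose that for all $t\in\mathbb{R}$ $$B(t)=W(t)\begin{bmatrix}\Sigma(t)\\0\end{bmatrix}V(t)^H,\qquad \Sigma(t)=\mathrm{diag}(\Sigma_1(t),\ldots,\Sigma_k(t)),$$ where $\Sigma_j(t)\in\mathbb{C}^{r_j\times r_j}$ are analytic in $t$ (not necessarily diagonal), $W(t)=[W_1(t),\ldots,W_k(t),W_{k+1}(t)]\in\mathbb{C}^{m\times m}$ and $V(t)=[V_1(t),\ldots,V_k(t)]\in\mathbb{C}^{n\times n}$ are unitary and analytic in $t$, with $W_j(t)\in\mathbb{C}^{m\times r_j}$, $V_j(t)\in\mathbb{C}^{n\times r_j}$ for $j=1,\dots,k$ and $W_{k+1}(t)\in\mathbb{C}^{m\times(m-n)}$, and $$W_j(t)^H\dot W_j(t)=0,\ \ j=1,\ldots,k+1,\qquad V_j(t)^H\dot V_j(t)=0,\ \ j=1,\ldots,k .$$ Define $$\rho_{ji}(t)=\min_{\sigma_1\in\sigma(\Sigma_j(t)),\ \sigma_2\in\sigma(\Sigma_i(t))}|\sigma_1-\sigma_2|,\qquad \rho_j(t)=\min_{i\ne j}\rho_{ji}(t),\qquad \sigma_{j,\min}(t)=\min\sigma(\Sigma_j(t)),$$ $$\widehat\rho_j(t)=\min\{\rho_j(t),\sigma_{j,\min}(t)\},\qquad \sigma_{\min}(t)=\min_j\sigma_{j,\min}(t),$$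 $$\rho_{j,\min}=\min_{0\le t\le1}\rho_j(t),\qquad \widehat\rho_{j,\min}=\min_{0\le t\le1}\widehat\rho_j(t),\qquad \sigma_{\min}=\min_{0\le t\le1}\sigma_{\min}(t).$$ Put $\widetilde B=B(1)=B+\Delta B$, $W_j=W_j(0)$, $\widetilde W_j=W_j(1)$ for $j=1,\dots,k+1$, and $V_j=V_j(0)$, $\widetilde V_j=V_j(1)$ for $j=1,\dots,k$. Then $$\|\mathrm{Sing}^{\downarrow}(\widetilde B)-\mathrm{Sing}^{\downarrow}(B)\|_F^2+\sum_{j=1}^k\frac{\widehat\rho_{j,\min}^2}{2}\|\widetilde W_j-W_j\|_F^2+\frac{\sigma_{\min}^2}{2}\|\widetilde W_{k+1}-W_{k+1}\|_F^2+\sum_{j=1}^k\frac{\rho_{j,\min}^2}{2}\|\widetilde V_j-V_j\|_F^2\le\|\Delta B\|_F^2 .$$ In particular, when $m=n$, $$\|\mathrm{Sing}^{\downarrow}(\widetilde B)-\mathrm{Sing}^{\downarrow}(B)\|_F^2+\sum_{j=1}^k\frac{\rho_{j,\min}^2}{2}\left(\|\widetilde W_j-W_j\|_F^2+\|\widetilde V_j-V_j\|_F^2\right)\le\|\Delta B\|_F^2 .$$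
   Context: $X^H$ is the conjugate transpose, $\|\cdot\|_F$ the Frobenius norm, $\sigma(X)$ the set of singular values of $X$, and $\dot F(t)=dF(t)/dt$. ''Analytic'' means real-analytic in the real variable $t$ (entrywise). For an $m\times n$ matrix $X$ with $m\ge n$, $\mathrm{Sing}^{\downarrow}(X)$ denotes the $n\times n$ diagonal matrix whose diagonal entries are the $n$ singular values of $X$ (with multiplicity) in nonincreasing order. When $m=n$, the block $W_{k+1}(t)$ and the zero block below $\Sigma(t)$ are void, and conditions and terms involving $W_{k+1}$ are absent. Convention for $k=1$: a minimum over the empty set is $+\infty$ (so $\rho_{1,\min}=+\infty$ and $\widehat\rho_1(t)=\sigma_{1,\min}(t)$), and $\infty\cdot 0=0$ (in that case $\widetilde V_1=V_1$, and if $m=n$ also $\widetilde W_1=W_1$). *)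

(* Defs.v *)
From mathcomp Require Import all_boot all_order all_algebra.
From mathcomp Require Import all_classical all_reals all_analysis.
From mathcomp Require Export complex.

Set Implicit Arguments.
Unset Strict Implicit.
Unset Printing Implicit Defensive.

Import Order.TTheory GRing.Theory Num.Theory.
Import numFieldNormedType.Exports.

Local Open Scope classical_set_scope.
Local Open Scope ring_scope.
Local Open Scope complex_scope.
Local Open Scope sesquilinear_scope.

Section MatrixNotions.
Context {R : realType}.

Definition frobenius p q (X : 'M[R[i]]_(p, q)) : R :=
  Num.sqrt (\sum_i \sum_j Normc.normc (X i j) ^+ 2).

(* Square roots of the eigenvalues of X^H X, with multiplicity and in
   nonincreasing order.  The list has one entry per column of X, so it is the
   list of singular values of X only when X has at least as many rows as
   columns. [X ^t* *m X] is Hermitian positive semidefinite, hence its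
   eigenvalues are real and nonnegative, and [complex.Re] loses nothing. *)
Definition singular_values p q (X : 'M[R[i]]_(p, q)) : seq R :=
  sort (fun x y : R => y <= x)
    [seq Num.sqrt (complex.Re (spectral_diag (X ^t* *m X) 0 i)) | i <- enum 'I_q].

Definition Sing p q (X : 'M[R[i]]_(p, q)) : 'M[R[i]]_q :=
  diag_mx (\row_i ((singular_values X)`_i)%:C).

(* The dimensions p and q are only propositionally equal in the intended uses,
   so both identities are required, which makes X square and unitary. *)
Definition unitary p q (X : 'M[R[i]]_(p, q)) : Prop :=
  X ^t* *m X = 1%:M /\ X *m X ^t* = 1%:M.

Definition real_analytic (f : R -> R) : Prop :=
  forall t0 : R, exists (a : nat -> R) (e : R), 0 < e /\
    forall t : R, `|t - t0| < e ->
      series (fun l : nat => a l * (t - t0) ^+ l) @ \oo --> f t.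

Definition mx_analytic p q (F : R -> 'M[R[i]]_(p, q)) : Prop :=
  forall i j, real_analytic (fun t => complex.Re (F t i j)) /\
              real_analytic (fun t => complex.Im (F t i j)).

Definition mx_derive p q (F : R -> 'M[R[i]]_(p, q)) (t : R) : 'M[R[i]]_(p, q) :=
  \matrix_(i, j) (derive1 (fun s => complex.Re (F s i j)) t
                  +i* derive1 (fun s => complex.Im (F s i j)) t).

End MatrixNotions.

(* Minima are taken in [\bar R], so that the minimum over an empty family is
   [+oo]; moreover [+oo * 0 = 0] in [\bar R]. *)
Section Gaps.
Local Open Scope ereal_scope.
Context {R : realType} {k : nat} {r : 'I_k -> nat}.
Variable Sigma : forall j : 'I_k, R -> 'M[R[i]]_(r j).

Definition rho_pair (j i : 'I_k) (t : R) : \bar R :=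
  \big[Order.min/+oo]_(s1 <- singular_values (Sigma j t))
    \big[Order.min/+oo]_(s2 <- singular_values (Sigma i t)) `|s1 - s2|%R%:E.

Definition rho (j : 'I_k) (t : R) : \bar R :=
  \big[Order.min/+oo]_(i < k | i != j) rho_pair j i t.

Definition sigma_block (j : 'I_k) (t : R) : \bar R :=
  \big[Order.min/+oo]_(s <- singular_values (Sigma j t)) s%:E.

Definition rho_hat (j : 'I_k) (t : R) : \bar R :=
  Order.min (rho j t) (sigma_block j t).

Definition sigma_all (t : R) : \bar R :=
  \big[Order.min/+oo]_(j < k) sigma_block j t.

(* Used on continuous functions of t, for which the infimum is attained. *)
Definition min01 (f : R -> \bar R) : \bar R :=
  ereal_inf [set f t | t in `[0%R, 1%R]].

Definition rho_min (j : 'I_k) : \bar R := min01 (rho j).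
Definition rho_hat_min (j : 'I_k) : \bar R := min01 (rho_hat j).
Definition sigma_min : \bar R := min01 sigma_all.

End Gaps.

(* Main.v *)
Require Import Defs.
From mathcomp Require Import all_boot all_order all_algebra all_fingroup.
From mathcomp Require Import all_classical all_reals all_analysis.
From mathcomp Require Import ring lra.

(** Write a prime for d/dt and put [K i j := W_i^H W_j'] and [L i j := V_i^H V_j'].
    Differentiating [B + t dB = \sum_j W_j Sigma_j V_j^H] and reading the result in the moving
    orthonormal frames gives the blocks of [dB]:
    - [W_i^H dB V_j = K i j Sigma_j - Sigma_i L i j] for [i != j];
    - [W_i^H dB V_i = Sigma_i'], because the diagonal blocks of K and L vanish by hypothesis;
    - [Wlast^H dB V_j = (Wlast^H W_j') Sigma_j].
    The frames are unitary, so the squared Frobenius norm of [dB] is the sum of the squared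
    norms of these blocks.  Differentiating the orthonormality relations shows that K and L are
    skew-Hermitian, so the blocks (i, j) and (j, i) involve the same two unknowns; after a
    singular value decomposition of [Sigma_i] and [Sigma_j] they reduce to pairs of scalars
    [s' x - s y] and [s x - s' y], with singular values s and s', whose squares add up
    to at least the squared gap times the squared norms of the unknowns ([sv_gap_pair]).  The
    norm of the last block is at least that of [Wlast^H W_j'] times the smallest singular value
    of [Sigma_j] ([sv_gap_mulr]).  Summing, the squared speeds of [Sigma_j],
    [W_j], [Wlast] and [V_j], with weights that do not depend on t in [0, 1], add up to at most
    the squared norm of [dB] ([pointwise_bound], [path_bound]).

    A bound on speeds is a bound on displacements by the mean value theorem, applied to the
    scalar function [t |-> \sum_X w_X <X(1) - X(0), X(t)>] ([integrated_bound]).  Finally, the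
    singular values of [B + t dB] are those of the block diagonal matrix of the [Sigma_j], and
    Mirsky's inequality ([mirsky]) says that they move at most as far as that matrix does.

    The weights are extended reals.  The gap of a block is infinite only if there is no other
    block, and then the frame is square and its derivative is zero, so that the corresponding
    term is zero. *)

Set Implicit Arguments.
Unset Strict Implicit.
Unset Printing Implicit Defensive.

Import Order.TTheory GRing.Theory Num.Theory.

Local Open Scope ring_scope.
Local Open Scope complex_scope.
Local Open Scope sesquilinear_scope.

(** * The Frobenius inner product *)

Section FrobeniusInnerProduct.
Context {R : realType}.
Local Notation C := R[i].
Local Notation Re := (@complex.Re R).
Local Notation Im := (@complex.Im R).

Lemma cre_conj (x : C) : Re (Num.conj x) = Re x. Proof. by case: x. Qed.
Lemma cim_conj (x : C) : Im (Num.conj x) = - Im x. Proof. by case: x. Qed.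
Lemma creD (x y : C) : Re (x + y) = Re x + Re y. Proof. by case: x y => a b []. Qed.
Lemma creB (x y : C) : Re (x - y) = Re x - Re y. Proof. by case: x y => a b []. Qed.
Lemma cimD (x y : C) : Im (x + y) = Im x + Im y. Proof. by case: x y => a b []. Qed.
Lemma cimB (x y : C) : Im (x - y) = Im x - Im y. Proof. by case: x y => a b []. Qed.
Lemma creM (x y : C) : Re (x * y) = Re x * Re y - Im x * Im y.
Proof. by case: x y => a b []. Qed.
Lemma cimM (x y : C) : Im (x * y) = Re x * Im y + Im x * Re y.
Proof. by case: x y => a b []. Qed.
Lemma cre_sum I (s : seq I) (P : pred I) (F : I -> C) :
  Re (\sum_(i <- s | P i) F i) = \sum_(i <- s | P i) Re (F i).
Proof. by rewrite (big_morph _ creD (erefl _ : Re 0 = 0)). Qed.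
Lemma cim_sum I (s : seq I) (P : pred I) (F : I -> C) :
  Im (\sum_(i <- s | P i) F i) = \sum_(i <- s | P i) Im (F i).
Proof. by rewrite (big_morph _ cimD (erefl _ : Im 0 = 0)). Qed.

Lemma adjM p q s (X : 'M[C]_(p, q)) (Y : 'M[C]_(q, s)) :
  (X *m Y) ^t* = Y ^t* *m X ^t*.
Proof. by rewrite trmx_mul map_mxM. Qed.
Lemma adjB p q (X Y : 'M[C]_(p, q)) : (X - Y) ^t* = X ^t* - Y ^t*.
Proof. by rewrite raddfB /= map_mxB. Qed.

Definition mxdot p q (X Y : 'M[C]_(p, q)) : R := Re (\tr (X ^t* *m Y)).
Definition frob2 p q (X : 'M[C]_(p, q)) : R := mxdot X X.
Definition normc2 (z : C) : R := Re z ^+ 2 + Im z ^+ 2.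

Lemma mxdotE p q (X Y : 'M[C]_(p, q)) :
  mxdot X Y = \sum_i \sum_j (Re (X i j) * Re (Y i j) + Im (X i j) * Im (Y i j)).
Proof.
rewrite /mxdot /mxtrace cre_sum exchange_big; apply: eq_bigr => j _.
rewrite mxE cre_sum; apply: eq_bigr => i _.
by rewrite !mxE creM cre_conj cim_conj; ring.
Qed.

Lemma frob2E p q (X : 'M[C]_(p, q)) : frob2 X = \sum_i \sum_j normc2 (X i j).
Proof.
rewrite /frob2 mxdotE; apply: eq_bigr => i _; apply: eq_bigr => j _.
by rewrite /normc2 !expr2.
Qed.

Lemma normc2_ge0 z : 0 <= normc2 z.
Proof. by rewrite addr_ge0 ?sqr_ge0. Qed.

Lemma normc2_conj z : normc2 (Num.conj z) = normc2 z.
Proof. by rewrite /normc2 cre_conj cim_conj sqrrN. Qed.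

Lemma normc2E (z : C) : (normc2 z)%:C = z * Num.conj z.
Proof.
case: z => a b; apply/eqP; rewrite eq_complex /= /normc2 /=.
by apply/andP; split; apply/eqP; ring.
Qed.

Lemma normc2_eq0 z : normc2 z = 0 -> z = 0.
Proof.
move=> /(congr1 (fun x : R => x%:C)); rewrite normc2E => /eqP.
by rewrite mulf_eq0 conjC_eq0 orbb => /eqP.
Qed.

Lemma frob2_ge0 p q (X : 'M[C]_(p, q)) : 0 <= frob2 X.
Proof. by rewrite frob2E; do 2!apply: sumr_ge0 => ? _; exact: normc2_ge0. Qed.

Lemma frob2_eq0 p q (X : 'M[C]_(p, q)) : frob2 X = 0 -> X = 0.
Proof.
move=> X0; apply/matrixP => i j; rewrite mxE; apply: normc2_eq0.
move: X0; rewrite frob2E => /eqP; rewrite psumr_eq0; last first.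
  by move=> ? _; apply: sumr_ge0 => ? _; exact: normc2_ge0.
move=> /allP /(_ i (mem_index_enum _)) /=.
rewrite psumr_eq0; last by move=> ? _; exact: normc2_ge0.
by move=> /allP /(_ j (mem_index_enum _)) /= /eqP.
Qed.

Lemma frobenius_sqr p q (X : 'M[C]_(p, q)) : frobenius X ^+ 2 = frob2 X.
Proof.
rewrite /frobenius sqr_sqrtr; last by do 2!apply: sumr_ge0 => ? _; exact: sqr_ge0.
rewrite frob2E; apply: eq_bigr => i _; apply: eq_bigr => j _.
by case: (X i j) => a b; rewrite /normc2 /= sqr_sqrtr // addr_ge0 ?sqr_ge0.
Qed.

Lemma mxdot_le p q (X Y : 'M[C]_(p, q)) : 2 * mxdot X Y <= frob2 X + frob2 Y.
Proof.
rewrite !frob2E mxdotE mulr_sumr -big_split; apply: ler_sum => i _ /=.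
rewrite mulr_sumr -big_split; apply: ler_sum => j _ /=.
rewrite /normc2 -subr_ge0.
set a := Re _; set b := Im _; set c := Re _; set d := Im _.
have -> : a ^+ 2 + b ^+ 2 + (c ^+ 2 + d ^+ 2) - 2 * (a * c + b * d) =
  (a - c) ^+ 2 + (b - d) ^+ 2 by ring.
by rewrite addr_ge0 ?sqr_ge0.
Qed.

Lemma mxdotB p q (X Y Z : 'M[C]_(p, q)) : mxdot X (Y - Z) = mxdot X Y - mxdot X Z.
Proof. by rewrite /mxdot mulmxBr raddfB creB. Qed.

Lemma mxdotC p q (X Y : 'M[C]_(p, q)) : mxdot X Y = mxdot Y X.
Proof. by rewrite !mxdotE; do 2!apply: eq_bigr => ? _; ring. Qed.

Lemma frob2B p q (X Y : 'M[C]_(p, q)) :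
  frob2 (X - Y) = frob2 X + frob2 Y - 2 * mxdot X Y.
Proof.
rewrite /frob2 mxdotB mxdotC mxdotB mxdotC (mxdotC (X - Y) Y) mxdotB.
by rewrite (mxdotC Y X) ; ring.
Qed.

Lemma frob2N p q (X : 'M[C]_(p, q)) : frob2 (- X) = frob2 X.
Proof.
rewrite !frob2E; do 2!apply: eq_bigr => ? _.
by rewrite mxE; case: (X _ _) => a b; rewrite /normc2 /= !sqrrN.
Qed.

Lemma frob2_adj p q (X : 'M[C]_(p, q)) : frob2 (X ^t* ) = frob2 X.
Proof.
rewrite !frob2E exchange_big; do 2!apply: eq_bigr => ? _.
by rewrite !mxE normc2_conj.
Qed.

Lemma frob2_mull p q s (U : 'M[C]_(s, p)) (X : 'M[C]_(p, q)) :
  U ^t* *m U = 1%:M -> frob2 (U *m X) = frob2 X.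
Proof. by move=> UU; rewrite /frob2 /mxdot adjM -mulmxA (mulmxA (U ^t* )) UU mul1mx. Qed.

Lemma frob2_mulr p q s (U : 'M[C]_(q, s)) (X : 'M[C]_(p, q)) :
  U *m U ^t* = 1%:M -> frob2 (X *m U) = frob2 X.
Proof. by move=> UU; rewrite -frob2_adj adjM frob2_mull ?trmxCK // frob2_adj. Qed.

(** Parseval's identity for a frame given by its resolution of the identity, a form that makes
    sense for blocks of different widths. *)
Lemma frob2_sum_l (I : finType) (d : I -> nat) p q e (U : forall i, 'M[C]_(p, d i))
    (U' : 'M[C]_(p, e)) (X : 'M[C]_(p, q)) :
  \sum_i U i *m (U i) ^t* + U' *m U' ^t* = 1%:M ->
  frob2 X = \sum_i frob2 ((U i) ^t* *m X) + frob2 (U' ^t* *m X).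
Proof.
move=> UU; rewrite {1}/frob2 {1}/mxdot -[X in _ *m X]mul1mx -UU.
rewrite mulmxDl mulmxDr mxtraceD creD mulmx_suml mulmx_sumr.
rewrite (big_morph _ (@mxtraceD _ _) (mxtrace0 _ _)) cre_sum.
congr (_ + _); [apply: eq_bigr => i _|];
  by rewrite /frob2 /mxdot adjM trmxCK !mulmxA.
Qed.

Lemma frob2_sum_r (I : finType) (d : I -> nat) p q (U : forall i, 'M[C]_(q, d i))
    (X : 'M[C]_(p, q)) :
  \sum_i U i *m (U i) ^t* = 1%:M ->
  frob2 X = \sum_i frob2 (X *m U i).
Proof.
move=> UU; rewrite -frob2_adj (@frob2_sum_l _ _ _ _ 0 U 0) ?mul0mx ?addr0 //.
rewrite -[RHS]addr0; congr (_ + _); last first.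
  by rewrite frob2E big_ord0.
by apply: eq_bigr => i _; rewrite -adjM frob2_adj.
Qed.

Lemma frob2_mxdiag (I : nat) (d : 'I_I -> nat) (X : forall i, 'M[C]_(d i)) :
  frob2 (\mxdiag_i X i) = \sum_i frob2 (X i).
Proof.
rewrite /frob2 /mxdot tr_mxdiag.
have -> : map_mx Num.conj (\mxdiag_i (X i)^T) = \mxdiag_i ((X i) ^t* ).
  apply/mxblockP => i j.
  have -> : submxblock (map_mx Num.conj (\mxdiag_i (X i)^T)) i j =
    map_mx Num.conj (submxblock (\mxdiag_i (X i)^T) i j) by apply/matrixP => a b; rewrite !mxE.
  rewrite !mxblockK; case: eqP => [ij|nij]; last by rewrite map_mx0.
  by subst j; rewrite !conform_mx_id.
rewrite mul_mxdiag_mxblock mxtrace_mxblock cre_sum.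
by apply: eq_bigr => i _; rewrite eqxx conform_mx_id.
Qed.

Lemma conj_realC (x : R) : Num.conj (x%:C : C) = x%:C.
Proof. by apply/eqP; rewrite eq_complex /= oppr0 !eqxx. Qed.

Lemma normc2Z (x : R) (z : C) : normc2 (x%:C * z) = x ^+ 2 * normc2 z.
Proof. by rewrite /normc2 creM cimM /=; ring. Qed.

End FrobeniusInnerProduct.

(** * Singular value decomposition *)

Section SVD.
Context {R : realType}.
Local Notation C := R[i].
Local Notation Re := (@complex.Re R).
Local Notation Im := (@complex.Im R).

Lemma geR_total : total (fun x y : R => y <= x).
Proof. by move=> x y; rewrite le_total. Qed.
Lemma geR_trans : transitive (fun x y : R => y <= x).
Proof. by move=> y x z /[swap] /le_trans; apply. Qed.
Lemma geR_anti : antisymmetric (fun x y : R => y <= x).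
Proof. by move=> x y; rewrite andbC => /le_anti. Qed.

Lemma size_singular_values p q (X : 'M[C]_(p, q)) : size (singular_values X) = q.
Proof. by rewrite size_sort size_map size_enum_ord. Qed.

Lemma singular_values_ge0 p q (X : 'M[C]_(p, q)) i : 0 <= (singular_values X)`_i.
Proof.
have [iq|qi] := ltnP i (size (singular_values X)); last by rewrite nth_default.
have := mem_nth 0 iq; rewrite mem_sort => /mapP[j _ ->]; exact: sqrtr_ge0.
Qed.

Lemma singular_values_antitone p q (X : 'M[C]_(p, q)) i j :
  (i <= j)%N -> (singular_values X)`_j <= (singular_values X)`_i.
Proof.
move=> ij; have [jq|qj] := ltnP j (size (singular_values X)); last first.
  by rewrite [X in X <= _]nth_default // singular_values_ge0.
have := sort_sorted geR_total
  [seq Num.sqrt (Re (spectral_diag (X ^t* *m X) 0 i)) | i <- enum 'I_q].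
move=> /(sorted_leq_nth geR_trans (fun x => lexx x)) => /(_ 0); apply => //.
exact: leq_ltn_trans jq.
Qed.

Lemma gram_hermitian p q (X : 'M[C]_(p, q)) : X ^t* *m X \is hermsymmx.
Proof.
by apply/is_hermitianmxP; rewrite expr0 scale1r adjM trmxCK.
Qed.

Lemma gram_spectral p q (X : 'M[C]_(p, q)) (P := spectralmx (X ^t* *m X)) :
  P *m (X ^t* *m X) *m P ^t* = diag_mx (spectral_diag (X ^t* *m X)).
Proof.
have /hermitian_normalmx/orthomx_spectralP E := gram_hermitian X.
rewrite {1}E invmx_unitary ?spectral_unitarymx // -/P.
have PP : P *m P ^t* = 1%:M by apply/unitarymxP; exact: spectral_unitarymx.
by rewrite !mulmxA PP mul1mx -mulmxA PP mulmx1.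
Qed.

Lemma spectral_diag_gram p q (X : 'M[C]_(p, q)) i :
  spectral_diag (X ^t* *m X) 0 i =
  ((Num.sqrt (Re (spectral_diag (X ^t* *m X) 0 i))) ^+ 2)%:C.
Proof.
set P := spectralmx (X ^t* *m X); set s := spectral_diag _.
have /matrixP/(_ i i) := gram_spectral X.
rewrite -/P -/s [in RHS]mxE eqxx mulr1n mulmxA -mulmxA -{1}(trmxCK P) -adjM mxE => E.
have {}E : s 0 i = (\sum_j normc2 ((X *m P ^t* ) j i))%:C.
  rewrite -E rmorph_sum; apply: eq_bigr => j _ /=.
  by rewrite normc2E !mxE mulrC.
rewrite E sqr_sqrtr //=; apply: sumr_ge0 => j _; exact: normc2_ge0.
Qed.

Lemma unitary_sqr n (U : 'M[C]_n) : U \is unitarymx -> U *m U ^t* = 1%:M /\ U ^t* *m U = 1%:M.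
Proof. by move=> /unitarymxP UU; split => //; apply: mulmx1C. Qed.

(** Gram-Schmidt gives [A = L U] with U unitary and L lower triangular with nonnegative diagonal.
    The rows of L have the Gram matrix of the rows of A, which is diagonal, and this forces L
    itself to be diagonal, row by row.  The order of [d] matters: if row k < i of L vanishes,
    orthogonality to it says nothing about row i, but then [d i <= d k = 0] and row i
    vanishes as well.  This route covers singular A, for which the rows of A cannot
    just be normalized. *)
Lemma row_orthogonal_factor n (A : 'M[C]_n) (d : nat -> R) :
  (forall i, 0 <= d i) -> (forall i j, (i <= j)%N -> d j <= d i) ->
  A *m A ^t* = diag_mx (\row_i ((d i) ^+ 2)%:C) ->
  exists2 U : 'M[C]_n, U \is unitarymx & A = diag_mx (\row_i (d i)%:C) *m U.
Proof.
move=> d0 dle AA; pose U := schmidt A.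
have Uu : U \is unitarymx by exact: schmidt_unitarymx.
have [UU1 UU2] := unitary_sqr Uu.
exists U => //; pose L := A *m U ^t*.
have AL : A = L *m U by rewrite -mulmxA UU2 mulmx1.
have LL : L *m L ^t* = diag_mx (\row_i ((d i) ^+ 2)%:C).
  by rewrite -AA /L adjM trmxCK mulmxA -(mulmxA A) UU2 mulmx1.
have Lup (i k : 'I_n) : (i < k)%N -> L i k = 0.
  move=> ik; have: (row i A <= kermx ((row k U) ^t* ))%MS.
    apply: submx_trans (row_schmidt_sub _ _) _; apply/sumsmx_subP => l li.
    rewrite genmxE; apply/sub_kermxP; apply/matrixP => a b; rewrite !ord1.
    have /matrixP/(_ l k) := UU1; rewrite !mxE.
    have -> : (l == k) = false by apply/eqP => lk; move: ik; rewrite -lk ltnNge li.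
    by move=> E0; apply: etrans E0; apply: eq_bigr => j _; rewrite !mxE.
  move=> /sub_kermxP/matrixP/(_ 0 0); rewrite !mxE => E0; apply: etrans E0.
  by apply: eq_bigr => j _; rewrite !mxE.
have Ld (i : 'I_n) : 0 <= L i i.
  have := form1_row_schmidt A i; rewrite dotmxE !mxE.
  by congr (_ <= _); apply: eq_bigr => j _; rewrite !mxE.
clearbody L => {AA}.
(* Strong induction on the row: the rows above are already known to be diagonal. *)
have Lrow (i : 'I_n) : forall k, L i k = if i == k then (d i)%:C else 0.
  have [N iN] := ubnP i; elim: N i iN => // N IH i iN.
  have nrm : \sum_l (normc2 (L i l))%:C = ((d i) ^+ 2)%:C.
    have /matrixP/(_ i i) := LL; rewrite !mxE eqxx mulr1n => <-.
    by apply: eq_bigr => l _; rewrite normc2E !mxE.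
  have low (k : 'I_n) : (k < i)%N -> L i k = 0.
    move=> ki; have Lk := IH k (leq_trans ki iN).
    have [dk0|dk0] := eqVneq (d k) 0.
      have di0 : d i = 0.
        by apply/eqP; rewrite eq_le d0 andbT -dk0 dle // ltnW.
      apply: normc2_eq0; move: nrm; rewrite di0 expr0n -rmorph_sum => /complexI/eqP.
      rewrite psumr_eq0 => [/allP/(_ k (mem_index_enum _))/eqP//|l _].
      exact: normc2_ge0.
    have /matrixP/(_ i k) := LL; rewrite !mxE.
    have -> : (i == k) = false by apply/eqP => ik; rewrite ik ltnn in ki.
    rewrite (bigD1 k) //= big1 ?addr0 => [|l lk].
      rewrite !mxE Lk eqxx conj_realC => /eqP; rewrite mulf_eq0 => /orP[/eqP//|].
      by move=> /eqP/complexI dk; rewrite dk eqxx in dk0.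
    by rewrite !mxE Lk eq_sym (negPf lk) conjC0 mulr0.
  have offd k : k != i -> L i k = 0.
    by move=> ki; case: (ltngtP i k) => [/Lup//|/low//|/val_inj ik]; rewrite ik eqxx in ki.
  move=> k; have [<-{k}|ki] := eqVneq; last by rewrite offd // eq_sym.
  move: nrm; rewrite (bigD1 i) //= big1 ?addr0 => [|l li]; last first.
    by rewrite offd // /normc2 /= expr0n addr0.
  move: (Ld i); case: (L i i) => a b; rewrite lecE /= => /andP[/eqP b0 a0].
  rewrite /normc2 /= b0 expr0n addr0 => /complexI /eqP.
  by rewrite eqrXn2 // => /eqP ->.
rewrite {1}AL; congr (_ *m _); apply/matrixP => i k; rewrite Lrow !mxE.
by case: eqP => _; rewrite ?mulr1n ?mulr0n.
Qed.

Lemma singular_values_perm p q (X : 'M[C]_(p, q)) : exists s : 'S_q, forall i : 'I_q,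
  (singular_values X)`_i = Num.sqrt (Re (spectral_diag (X ^t* *m X) 0 (s i))).
Proof.
set f := fun i => Num.sqrt (Re (spectral_diag (X ^t* *m X) 0 i)).
have sz : size (singular_values X) == q by rewrite size_singular_values.
have : perm_eq (Tuple sz) [tuple f i | i < q] by rewrite /= perm_sort.
move=> /tuple_permP [s E]; exists s => i.
have -> : (singular_values X)`_i = tnth (Tuple sz) i by rewrite (tnth_nth 0).
by rewrite (tnth_nth 0) E -tnth_nth !tnth_mktuple.
Qed.

(** Diagonalize [A^H A = Q^H D^2 Q] with eigenvalues in nonincreasing order; then [Q A^H] has
    orthogonal rows of lengths D, and [row_orthogonal_factor] extracts the other unitary factor. *)
Lemma svd n (A : 'M[C]_n) : exists P Q : 'M[C]_n,
  [/\ P \is unitarymx, Q \is unitarymx & A = P *m Sing A *m Q].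
Proof.
have [s sP] := singular_values_perm A.
set Q0 := spectralmx (A ^t* *m A).
have Q0u : Q0 \is unitarymx by exact: spectral_unitarymx.
have [Q1 Q2] := unitary_sqr Q0u.
pose Q := row_perm s Q0.
have QQ : Q \is unitarymx.
  apply/unitarymxP/matrixP => i j; have /matrixP/(_ (s i) (s j)) := Q1.
  rewrite !mxE (inj_eq perm_inj) => <-; apply: eq_bigr => l _.
  by rewrite !mxE.
have [QQ1 QQ2] := unitary_sqr QQ.
have [|||U Uu E] := @row_orthogonal_factor n (Q *m A ^t* ) (fun i => (singular_values A)`_i).
- by move=> i; exact: singular_values_ge0.
- by move=> i j; exact: singular_values_antitone.
- rewrite adjM trmxCK.
  have := gram_spectral A; rewrite -/Q0 => /matrixP G; apply/matrixP => i j.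
  have := G (s i) (s j).
  rewrite [in RHS]mxE spectral_diag_gram -sP (inj_eq perm_inj) => E0.
  rewrite [RHS]mxE [X in _ = X *+ _]mxE; apply: etrans E0.
  rewrite -!mulmxA mulmxA [in RHS]mulmxA mxE [RHS]mxE.
  by apply: eq_bigr => l _; congr (_ * _); rewrite !mxE; apply: eq_bigr => l' _; rewrite !mxE.
exists (U ^t* ), Q; split; [by rewrite trmxC_unitary | exact: QQ |].
rewrite -[LHS]mulmx1 -QQ2 mulmxA; congr (_ *m _).
rewrite -[A]trmxCK -adjM E adjM; congr (_ *m _).
apply/matrixP => i j; rewrite !mxE eq_sym.
by case: eqP => [->|_]; rewrite ?mulr1n ?mulr0n ?conjC0 // conj_realC trmxCK.
Qed.

Lemma char_poly_unitary n (U A : 'M[C]_n) : U \is unitarymx ->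
  char_poly (U *m A *m U ^t* ) = char_poly A.
Proof.
move=> Uu; have [U1 U2] := unitary_sqr Uu.
rewrite /char_poly.
have -> : char_poly_mx (U *m A *m U ^t* ) =
    map_mx polyC U *m char_poly_mx A *m map_mx polyC (U ^t* ).
  rewrite /char_poly_mx mulmxBr mulmxBl !map_mxM; congr (_ - _).
  by rewrite -mulmxA mul_scalar_mx -scalemxAr -map_mxM U1 map_mx1 scalemx1.
rewrite !det_mulmx mulrC mulrA -det_mulmx -map_mxM U2 map_mx1 det1 mul1r //.
Qed.

Lemma spectral_diag_char_poly n (A : 'M[C]_n) : A \is hermsymmx ->
  char_poly A = \prod_(x <- [seq spectral_diag A 0 i | i <- enum 'I_n]) ('X - x%:P).
Proof.
move=> /hermitian_normalmx/orthomx_spectralP E.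
have Uu := spectral_unitarymx A; rewrite {1}E invmx_unitary //.
rewrite -{2}(trmxCK (spectralmx A)) char_poly_unitary ?trmxC_unitary //.
rewrite char_poly_trig ?diag_mx_is_trig // big_map big_enum.
by apply: eq_bigr => i _; rewrite mxE eqxx mulr1n.
Qed.

(** The choice of a diagonalization in [spectral_diag] is immaterial after sorting: the two
    Gram matrices have the same characteristic polynomial. *)
Lemma singular_values_unitary p p' q (X : 'M[C]_(p, q)) (Y : 'M[C]_(p', q)) (U : 'M[C]_q) :
  U \is unitarymx -> X ^t* *m X = U *m (Y ^t* *m Y) *m U ^t* ->
  singular_values X = singular_values Y.
Proof.
move=> Uu E; apply/(perm_sortP geR_total geR_trans geR_anti).
rewrite 2!(map_comp (fun z => Num.sqrt (Re z)) (fun i => spectral_diag _ 0 i)); apply: perm_map.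
apply: prod_XsubC_eq.
rewrite -(spectral_diag_char_poly (gram_hermitian X)) -(spectral_diag_char_poly (gram_hermitian Y)).
by rewrite E char_poly_unitary.
Qed.

End SVD.

(** * Mirsky's inequality and singular value gaps *)

Section Perturbation.
Context {R : realType}.
Local Notation C := R[i].
Local Notation Re := (@complex.Re R).
Local Notation Im := (@complex.Im R).

(** Abel summation: a sequence ending at 0 is the superposition of the indicators of initial
    segments, weighted by its decrements. *)
Lemma layer_cake n (d : nat -> R) (i : 'I_n) : d n = 0 ->
  d i = \sum_(p < n) (d p - d p.+1) * (i <= p)%:R.
Proof.
move=> dn; rewrite -(big_mkord xpredT (fun p => (d p - d p.+1) * (i <= p)%:R)).
rewrite (big_cat_nat (leq0n i) (ltnW (ltn_ord i))) big_nat_cond big1 ?add0r; last first.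
  by move=> p /andP[/andP[_ pi] _]; rewrite leqNgt pi mulr0.
rewrite (@GRing.telescope_sumr_eq _ _ _ (fun p => - d p)) ?(ltnW (ltn_ord i)) //.
  by rewrite [RHS]add0r dn oppr0 sub0r opprK.
by move=> p /andP[ip _]; rewrite ip mulr1 opprK addrC.
Qed.

(** By [layer_cake] both sides are superpositions, with the same nonnegative weights, of their
    values for indicators of [i <= p] and [j <= q].  There the left-hand side is the mass of M in a
    corner with p + 1 rows and q + 1 columns, at most the smaller of p + 1 and q + 1. *)
Lemma rearrangement n (d d' : nat -> R) (M : 'I_n -> 'I_n -> R) :
  d n = 0 -> d' n = 0 ->
  (forall p, d p.+1 <= d p) -> (forall p, d' p.+1 <= d' p) ->
  (forall i j, 0 <= M i j) ->
  (forall i, \sum_j M i j <= 1) -> (forall j, \sum_i M i j <= 1) ->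
  \sum_(i < n) \sum_(j < n) d i * d' j * M i j <= \sum_(i < n) d i * d' i.
Proof.
move=> dn d'n dd dd' M0 Mr Mc.
pose a p := d p - d p.+1; pose b p := d' p - d' p.+1.
have a0 p : 0 <= a p by rewrite subr_ge0.
have b0 p : 0 <= b p by rewrite subr_ge0.
have -> : \sum_(i < n) \sum_(j < n) d i * d' j * M i j =
  \sum_(p < n) \sum_(q < n) a p * b q *
    \sum_(i < n) \sum_(j < n) (i <= p)%:R * (j <= q)%:R * M i j.
  transitivity (\sum_(i < n) \sum_(j < n) \sum_(p < n) \sum_(q < n)
      a p * b q * ((i <= p)%:R * (j <= q)%:R * M i j)).
    apply: eq_bigr => i _; apply: eq_bigr => j _.
    rewrite (layer_cake i dn) (layer_cake j d'n) big_distrlr mulr_suml.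
    by apply: eq_bigr => p _; rewrite mulr_suml; apply: eq_bigr => q _; rewrite /a /b /=; ring.
  under eq_bigr => i _ do rewrite exchange_big.
  rewrite exchange_big; apply: eq_bigr => p _.
  under eq_bigr => i _ do rewrite exchange_big.
  rewrite exchange_big; apply: eq_bigr => q _.
  by rewrite mulr_sumr; apply: eq_bigr => i _; rewrite mulr_sumr.
have -> : \sum_(i < n) d i * d' i =
  \sum_(p < n) \sum_(q < n) a p * b q * \sum_(i < n) (i <= p)%:R * (i <= q)%:R.
  transitivity (\sum_(i < n) \sum_(p < n) \sum_(q < n)
      a p * b q * ((i <= p)%:R * (i <= q)%:R)).
    apply: eq_bigr => i _.
    rewrite (layer_cake i dn) (layer_cake i d'n) big_distrlr.
    by apply: eq_bigr => p _; apply: eq_bigr => q _; rewrite /a /b /=; ring.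
  rewrite exchange_big; apply: eq_bigr => p _.
  rewrite exchange_big; apply: eq_bigr => q _.
  by rewrite mulr_sumr.
apply: ler_sum => p _; apply: ler_sum => q _.
apply: ler_wpM2l; first exact: mulr_ge0.
(* The claim for the corner is symmetric, so it is enough to sum over its shorter side. *)
have half (N : 'I_n -> 'I_n -> R) (p' q' : nat) : (p' <= q')%N ->
    (forall i j, 0 <= N i j) -> (forall i, \sum_j N i j <= 1) ->
    \sum_(i < n) \sum_(j < n) (i <= p')%:R * (j <= q')%:R * N i j <=
    \sum_(i < n) (i <= p')%:R * (i <= q')%:R.
  move=> pq N0 Nr; apply: ler_sum => i _.
  have [ip|_] := leqP i p'; last by rewrite mul0r big1 // => j _; rewrite !mul0r.
  rewrite (leq_trans ip pq) mulr1; apply: le_trans (Nr i); apply: ler_sum => j _.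
  by rewrite mul1r ler_piMl // lern1 leq_b1.
have [pq|/ltnW qp] := leqP p q; first exact: half.
rewrite exchange_big; have := half (fun i j => M j i) _ _ qp.
under [X in X <= _]eq_bigr => i _ do under eq_bigr => j _ do rewrite [X in X * _]mulrC.
by under [X in _ <= X]eq_bigr => i _ do rewrite mulrC; apply.
Qed.

Local Notation sv A i := (singular_values A)`_i.

Lemma unitary_row_sum n (U : 'M[C]_n) i : U \is unitarymx -> \sum_j normc2 (U i j) = 1.
Proof.
move=> /unitarymxP/matrixP/(_ i i); rewrite [in RHS]mxE eqxx mxE => E.
apply: complexI; rewrite rmorph_sum; apply: etrans E.
by apply: eq_bigr => j _; rewrite /= normc2E !mxE.
Qed.

Lemma unitary_col_sum n (U : 'M[C]_n) j : U \is unitarymx -> \sum_i normc2 (U i j) = 1.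
Proof.
rewrite -trmxC_unitary => /unitary_row_sum => /(_ j) E; apply: etrans E.
by apply: eq_bigr => i _; rewrite !mxE normc2_conj.
Qed.

Lemma frob2_unitary n p (U : 'M[C]_n) (X : 'M[C]_(n, p)) :
  U \is unitarymx -> frob2 (U *m X) = frob2 X.
Proof. by move=> /unitary_sqr[_]; exact: frob2_mull. Qed.

Lemma frob2_unitaryr n p (U : 'M[C]_n) (X : 'M[C]_(p, n)) :
  U \is unitarymx -> frob2 (X *m U) = frob2 X.
Proof. by move=> /unitary_sqr[U1 _]; exact: frob2_mulr. Qed.

Lemma Sing_mul n p (A : 'M[C]_n) (X : 'M[C]_(n, p)) i j :
  (Sing A *m X) i j = (sv A i)%:C * X i j.
Proof. by rewrite mul_diag_mx !mxE. Qed.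

Lemma mul_Sing n p (A : 'M[C]_n) (X : 'M[C]_(p, n)) i j :
  (X *m Sing A) i j = (sv A j)%:C * X i j.
Proof. by rewrite mul_mx_diag !mxE mulrC. Qed.

Lemma Sing_adj n (A : 'M[C]_n) : (Sing A) ^t* = Sing A.
Proof.
apply/matrixP => i j; rewrite !mxE eq_sym.
by case: eqP => [->|_]; rewrite ?mulr1n ?mulr0n ?conjC0 // conj_realC.
Qed.

Lemma frob2_svd n (A P Q : 'M[C]_n) : P \is unitarymx -> Q \is unitarymx ->
  A = P *m Sing A *m Q -> frob2 A = frob2 (Sing A).
Proof. by move=> Pu Qu E; rewrite [X in frob2 X = _]E frob2_unitaryr ?frob2_unitary. Qed.

Lemma sv_default n (A : 'M[C]_n) : sv A n = 0.
Proof. by rewrite nth_default // size_singular_values. Qed.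

Lemma mxdot_Sing n (A B : 'M[C]_n) :
  mxdot (Sing A) (Sing B) = \sum_(i < n) sv A i * sv B i.
Proof.
rewrite mxdotE; apply: eq_bigr => i _; rewrite (bigD1 i) //= big1 ?addr0.
  by rewrite !mxE eqxx !mulr1n /= mulr0 addr0.
by move=> j ji; rewrite !mxE eq_sym (negPf ji) !mulr0n /= !mulr0 addr0.
Qed.

(** With [A = P D Q] and [B = P' D' Q'], the inner product is [\sum_ij d_i d'_j Re (U_ij Z_ji)]
    for the unitary matrices [U = P^H P'] and [Z = Q' Q^H].  Bounding the real part by the mean of
    the squared moduli gives a doubly stochastic matrix, to which [rearrangement] applies. *)
Lemma von_neumann_trace n (A B : 'M[C]_n) :
  mxdot A B <= mxdot (Sing A) (Sing B).
Proof.
have [P [Q [Pu Qu EA]]] := svd A; have [P' [Q' [P'u Q'u EB]]] := svd B.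
pose U := P ^t* *m P'; pose Z := Q' *m Q ^t*.
have Pu' : P ^t* \is unitarymx by rewrite trmxC_unitary; exact: Pu.
have Qu' : Q ^t* \is unitarymx by rewrite trmxC_unitary; exact: Qu.
have Uu : U \is unitarymx by exact: mul_unitarymx Pu' P'u.
have Zu : Z \is unitarymx by exact: mul_unitarymx Q'u Qu'.
have -> : mxdot A B = \sum_(i < n) \sum_(j < n) sv A i * sv B j * Re (U i j * Z j i).
  rewrite /mxdot {1}EA {1}EB !adjM Sing_adj -!mulmxA mxtrace_mulC -!mulmxA.
  rewrite (mulmxA (P ^t* )) -/U -/Z /mxtrace cre_sum; apply: eq_bigr => i _.
  rewrite Sing_mul mulmxA mxE mulr_sumr cre_sum; apply: eq_bigr => j _.
  by rewrite mul_Sing !creM !cimM /=; ring.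
rewrite mxdot_Sing.
pose M i j := (normc2 (U i j) + normc2 (Z j i)) / 2.
apply: (@le_trans _ _ (\sum_(i < n) \sum_(j < n) sv A i * sv B j * M i j)).
  apply: ler_sum => i _; apply: ler_sum => j _.
  apply: ler_wpM2l; first by rewrite mulr_ge0 // singular_values_ge0.
  rewrite /M /normc2 creM.
  set a := Re _; set b := Re _; set c := Im _; set d := Im _.
  have := sqr_ge0 (a - b); have := sqr_ge0 (c + d); rewrite sqrrB sqrrD; lra.
apply: rearrangement; rewrite ?sv_default //.
- by move=> p; exact: singular_values_antitone.
- by move=> p; exact: singular_values_antitone.
- by move=> i j; rewrite /M divr_ge0 // addr_ge0 // normc2_ge0.
- by move=> i; rewrite -mulr_suml big_split /= (unitary_row_sum i Uu) (unitary_col_sum i Zu) divff.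
- by move=> i; rewrite -mulr_suml big_split /= (unitary_col_sum i Uu) (unitary_row_sum i Zu) divff.
Qed.

(** [A] and [Sing A] have the same Frobenius norm, so that the two sides differ only by their
    cross terms, which [von_neumann_trace] compares. *)
Lemma mirsky n (A B : 'M[C]_n) : frob2 (Sing A - Sing B) <= frob2 (A - B).
Proof.
have [P [Q [Pu Qu EA]]] := svd A; have [P' [Q' [P'u Q'u EB]]] := svd B.
rewrite !frob2B (frob2_svd Pu Qu EA) (frob2_svd P'u Q'u EB).
by rewrite lerB // ler_pM2l //; exact: von_neumann_trace.
Qed.

Lemma sv_gap_mulr p q (A : 'M[C]_q) (K : 'M[C]_(p, q)) (g : R) :
  0 <= g -> (forall s, s \in singular_values A -> g <= s) ->
  g ^+ 2 * frob2 K <= frob2 (K *m A).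
Proof.
move=> g0 gA; have [P [Q [Pu Qu EA]]] := svd A.
rewrite {1}EA !mulmxA frob2_unitaryr // -(frob2_unitaryr K Pu) !frob2E mulr_sumr.
apply: ler_sum => i _; rewrite mulr_sumr; apply: ler_sum => j _.
rewrite mul_Sing normc2Z ler_wpM2r ?normc2_ge0 // ler_sqr ?nnegrE ?singular_values_ge0 //.
by apply: gA; rewrite mem_nth // size_singular_values.
Qed.

Lemma entryB p q (X Y : 'M[C]_(p, q)) i j : (X - Y) i j = X i j - Y i j.
Proof. by rewrite !mxE. Qed.

Lemma sylvester_change_basis p q (P Q D : 'M[C]_p) (P' Q' D' : 'M[C]_q)
    (K L : 'M[C]_(p, q)) : P ^t* *m P = 1%:M -> Q' *m Q' ^t* = 1%:M ->
  P ^t* *m (K *m (P' *m D' *m Q') - P *m D *m Q *m L) *m Q' ^t* =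
  (P ^t* *m K *m P') *m D' - D *m (Q *m L *m Q' ^t* ).
Proof.
move=> PP QQ; rewrite mulmxBr mulmxBl.
have -> : P ^t* *m (K *m (P' *m D' *m Q')) *m Q' ^t* = P ^t* *m K *m P' *m D'.
  by rewrite !mulmxA -(mulmxA _ Q') QQ mulmx1.
by rewrite !mulmxA PP mul1mx.
Qed.

Lemma sylvester_change_basis_adj p q (P Q D : 'M[C]_p) (P' Q' D' : 'M[C]_q)
    (K L : 'M[C]_(p, q)) : Q *m Q ^t* = 1%:M -> P' ^t* *m P' = 1%:M ->
  Q *m ((P *m D *m Q) ^t* *m K - L *m (P' *m D' *m Q') ^t* ) *m P' =
  D ^t* *m (P ^t* *m K *m P') - (Q *m L *m Q' ^t* ) *m D' ^t*.
Proof.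
move=> QQ PP; rewrite mulmxBr mulmxBl !adjM.
have -> : Q *m (Q ^t* *m (D ^t* *m P ^t* ) *m K) *m P' = D ^t* *m (P ^t* *m K *m P').
  by rewrite !mulmxA QQ mul1mx.
by rewrite !mulmxA -(mulmxA _ (P' ^t* )) PP mulmx1.
Qed.

(** In bases of singular vectors both matrices on the right are obtained entrywise, and the claim
    becomes [(s' x - s y)^2 + (s x - s' y)^2 >= (s - s')^2 (x^2 + y^2)], whose two sides differ by
    [2 s s' (x - y)^2].  Neither square alone suffices: the first one vanishes when
    [s' x = s y]. *)
Lemma sv_gap_pair p q (A : 'M[C]_p) (B : 'M[C]_q) (K L : 'M[C]_(p, q)) (g : R) :
  0 <= g ->
  (forall s s', s \in singular_values A -> s' \in singular_values B -> g <= `|s - s'|) ->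
  g ^+ 2 * (frob2 K + frob2 L) <=
    frob2 (K *m B - A *m L) + frob2 (A ^t* *m K - L *m B ^t* ).
Proof.
move=> g0 gAB.
have [P [Q [Pu Qu EA]]] := svd A; have [P' [Q' [P'u Q'u EB]]] := svd B.
have [P1 P2] := unitary_sqr Pu; have [P'1 P'2] := unitary_sqr P'u.
have [Q1 Q2] := unitary_sqr Qu; have [Q'1 Q'2] := unitary_sqr Q'u.
have Pu' : P ^t* \is unitarymx by rewrite trmxC_unitary; exact: Pu.
have Qu' : Q' ^t* \is unitarymx by rewrite trmxC_unitary; exact: Q'u.
pose K' := P ^t* *m K *m P'; pose L' := Q *m L *m Q' ^t*.
have -> : frob2 K = frob2 K' by rewrite frob2_unitaryr // frob2_unitary.
have -> : frob2 L = frob2 L' by rewrite frob2_unitaryr // frob2_unitary.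
have -> : frob2 (K *m B - A *m L) = frob2 (K' *m Sing B - Sing A *m L').
  rewrite -(@sylvester_change_basis _ _ P Q (Sing A) P' Q' (Sing B) K L P2 Q'1) -EA -EB.
  by rewrite frob2_unitaryr ?frob2_unitary.
have -> : frob2 (A ^t* *m K - L *m B ^t* ) = frob2 (Sing A *m K' - L' *m Sing B).
  rewrite -[X in X *m K']Sing_adj -[X in L' *m X]Sing_adj.
  rewrite -(@sylvester_change_basis_adj _ _ P Q (Sing A) P' Q' (Sing B) K L Q1 P'2) -EA -EB.
  by rewrite frob2_unitaryr ?frob2_unitary.
rewrite !frob2E -!big_split mulr_sumr; apply: ler_sum => i _ /=.
rewrite -!big_split mulr_sumr; apply: ler_sum => j _ /=.
rewrite !entryB !Sing_mul !mul_Sing.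
move: (K' i j) (L' i j) => x y.
have : g <= `|sv A i - sv B j|.
  by apply: gAB; rewrite mem_nth // size_singular_values.
have := singular_values_ge0 A i; have := singular_values_ge0 B j.
move: (sv A i) (sv B j) => s s' s'0 s0 gs.
have gg : g ^+ 2 <= (s - s') ^+ 2.
  by rewrite -[X in _ <= X]real_normK ?num_real // ler_sqr ?nnegrE.
apply: le_trans (ler_wpM2r _ gg) _; first by rewrite addr_ge0 ?normc2_ge0.
rewrite /normc2 !creB !cimB !creM !cimM /= -subr_ge0.
move: (Re x) (Im x) (Re y) (Im y) => a b c d.
rewrite [X in 0 <= X](_ : _ = 2 * (s * s') * ((a - c) ^+ 2 + (b - d) ^+ 2)); last by ring.
by rewrite !mulr_ge0 // addr_ge0 // sqr_ge0.
Qed.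

End Perturbation.

(** * Derivatives of matrix functions *)

Section Calculus.
Import numFieldNormedType.Exports.
Local Open Scope classical_set_scope.
Context {R : realType}.
Local Notation C := R[i].
Local Notation Re := (@complex.Re R).
Local Notation Im := (@complex.Im R).

Lemma geometric_tail (a : nat -> R) (M x : R) (N : nat) : 0 <= x -> x <= 1 / 2 ->
  0 <= M -> (forall l, `|a l| <= M * x ^+ l) ->
  `|series a N.+2 - a 0%N - a 1%N| <= 2 * M * x ^+ 2.
Proof.
move=> x0 x2 M0 aM.
suff : `|series a N.+2 - a 0%N - a 1%N| <= 2 * M * x ^+ 2 - 2 * M * x ^+ N.+2.
  move=> h; apply: (le_trans h); rewrite lerBlDr lerDl.
  by rewrite mulr_ge0 ?exprn_ge0 // mulr_ge0.
elim: N => [|N IH].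
  by rewrite /series /= !big_nat_recr //= big_geq // subrr (_ : _ - _ = 0) ?normr0 //; ring.
have -> : series a N.+3 - a 0%N - a 1%N = (series a N.+2 - a 0%N - a 1%N) + a N.+2.
  by rewrite /series /= big_nat_recr //=; ring.
apply: (le_trans (ler_normD _ _)); apply: (le_trans (lerD IH (aM N.+2))).
have -> : x ^+ N.+3 = x ^+ N.+2 * x by rewrite [LHS]exprSr.
have Mx : 0 <= M * x ^+ N.+2 by rewrite mulr_ge0 // exprn_ge0.
have : M * x ^+ N.+2 * x <= M * x ^+ N.+2 * (1 / 2) by exact: ler_wpM2l.
by move: (x ^+ N.+2) (x ^+ 2) => u v; lra.
Qed.

(** Since every point is the centre of a power series for an analytic function, differentiability
    at the centre is all that is needed, and a second-order Taylor bound there gives it without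
    differentiating the series term by term.  Convergence at a point at distance d bounds
    [a l * d ^+ l], hence the tail from index 2 by a geometric series when [`|h| <= d / 2]. *)
Lemma power_series_quadratic (f : R -> R) (t0 : R) (a : nat -> R) (e : R) : 0 < e ->
  (forall t, `|t - t0| < e -> series (fun l => a l * (t - t0) ^+ l) @ \oo --> f t) ->
  exists d M, [/\ 0 < d, 0 <= M & forall h, `|h| <= d ->
    `|f (t0 + h) - a 0%N - a 1%N * h| <= M * h ^+ 2].
Proof.
move=> e0 fE; have [d d0 de] : exists2 d, 0 < d & d < e by exists (e / 2); lra.
have : cvgn (series (fun l => a l * d ^+ l)).
  apply/cvg_ex; exists (f (t0 + d)).
  have := fE (t0 + d); rewrite addrAC subrr add0r; apply.
  by rewrite ger0_norm // ltW.
move=> /cvg_series_cvg_0/cvgP/cvg_seq_bounded/pinfty_ex_gt0[M M0 aM].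
exists (d / 2), (2 * M / d ^+ 2); split; first by rewrite divr_gt0.
  by rewrite divr_ge0 ?exprn_ge0 ?mulr_ge0 // ltW.
move=> h hd; set x := `|h| / d.
have x0 : 0 <= x by rewrite divr_ge0 // ltW.
have x2 : x <= 1 / 2 by rewrite ler_pdivrMr //; lra.
have term l : `|a l * h ^+ l| <= M * x ^+ l.
  have := aM l I; rewrite /= => aMl.
  have -> : a l * h ^+ l = (a l * d ^+ l) * (h / d) ^+ l.
    have : d ^+ l != 0 by rewrite expf_neq0 ?gt_eqF.
    by rewrite expr_div_n; move: (h ^+ l) (d ^+ l) => u v v0; field.
  rewrite normrM normrX [`|h / d|]normrM normfV (ger0_norm (ltW d0)) -/x.
  by rewrite ler_wpM2r // exprn_ge0.
have lim : series (fun l => a l * h ^+ l) @ \oo --> f (t0 + h).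
  have := fE (t0 + h); rewrite addrAC subrr add0r; apply; lra.
have -> : 2 * M / d ^+ 2 * h ^+ 2 = 2 * M * x ^+ 2.
  by rewrite /x expr_div_n real_normK ?num_real //; field; rewrite gt_eqF.
have lim2 : `|series (fun l => a l * h ^+ l) n - a 0%N - a 1%N * h| @[n --> \oo] -->
    `|f (t0 + h) - a 0%N - a 1%N * h|.
  by apply: cvg_norm; apply: cvgB; [apply: cvgB => //|]; exact: cvg_cst.
apply: (cvgr_to_le lim2).
exists 2%N => //= -[|[|n]] // _.
have := @geometric_tail (fun l => a l * h ^+ l) M x n x0 x2 (ltW M0) term.
by rewrite expr0 expr1 mulr1.
Qed.

Lemma real_analytic_derivable (f : R -> R) t : real_analytic f -> derivable f t 1.
Proof.
move=> /(_ t)[a [e [e0 /(power_series_quadratic e0)[d [M [d0 M0 fM]]]]]].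
have f0 : f t = a 0%N.
  have := fM 0; rewrite normr0 addr0 mulr0 subr0 expr0n mulr0 normr_le0 subr_eq0.
  by move=> /(_ (ltW d0))/eqP.
apply/cvg_ex; exists (a 1%N); apply/cvgrPdist_le => eps eps0 /=.
near=> h.
have h0 : h != 0 by near: h; exact: nbhs_dnbhs_neq.
have hd : `|h| <= d by near: h; exact: dnbhs0_le.
have he : `|h| <= eps / (M + 1) by near: h; apply: dnbhs0_le; rewrite divr_gt0 // ltr_wpDl.
rewrite /GRing.scale /= mulr1 (addrC h) f0.
have -> : a 1%N - h^-1 * (f (t + h) - a 0%N) = - (h^-1 * (f (t + h) - a 0%N - a 1%N * h)).
  by field.
rewrite normrN normrM normfV ler_pdivrMl ?normr_gt0 //.
apply: (le_trans (fM h hd)); rewrite -real_normK ?num_real // expr2 mulrCA ler_wpM2l //.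
move: he; rewrite ler_pdivlMr ?ltr_wpDl // mulrDr mulr1 mulrC => he.
by apply: le_trans he; rewrite lerDl.
Unshelve. all: by end_near. Qed.

(** A complex matrix function is differentiated through its real coordinates, as in
    [mx_derive]. *)
Definition is_mx_derive p q (t : R) (F : R -> 'M[C]_(p, q)) (D : 'M[C]_(p, q)) :=
  forall i j, is_derive t (1 : R) (fun s => Re (F s i j)) (Re (D i j)) /\
              is_derive t (1 : R) (fun s => Im (F s i j)) (Im (D i j)).

Lemma mx_analytic_derive p q (F : R -> 'M[C]_(p, q)) t :
  mx_analytic F -> is_mx_derive t F (mx_derive F t).
Proof.
move=> Fa i j; have [Fr Fi] := Fa i j; rewrite mxE /= !derive1E.
by split; apply: derivableP; exact: real_analytic_derivable.
Qed.

Lemma is_derive_fsum n (h : 'I_n -> R -> R) (dh : 'I_n -> R) (t : R) :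
  (forall i, is_derive t (1 : R) (h i) (dh i)) ->
  is_derive t (1 : R) (fun s => \sum_(i < n) h i s) (\sum_(i < n) dh i).
Proof.
move=> H; have -> : (fun s => \sum_(i < n) h i s) = \sum_(i < n) h i.
  by apply/funext => s; rewrite fct_sumE.
exact: is_derive_sum.
Qed.

Lemma is_derive_fM (f g : R -> R) (df dg t : R) :
  is_derive t (1 : R) f df -> is_derive t (1 : R) g dg ->
  is_derive t (1 : R) (fun s => f s * g s) (f t * dg + df * g t).
Proof. by move=> Hf Hg; rewrite (mulrC df); exact: is_deriveM. Qed.

Lemma is_derive_fD (f g : R -> R) (df dg t : R) :
  is_derive t (1 : R) f df -> is_derive t (1 : R) g dg ->
  is_derive t (1 : R) (fun s => f s + g s) (df + dg).
Proof. by move=> Hf Hg; exact: is_deriveD. Qed.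

Lemma is_derive_fB (f g : R -> R) (df dg t : R) :
  is_derive t (1 : R) f df -> is_derive t (1 : R) g dg ->
  is_derive t (1 : R) (fun s => f s - g s) (df - dg).
Proof. by move=> Hf Hg; exact: is_deriveB. Qed.

Lemma is_derive_feq (f g : R -> R) (df dg t : R) : f =1 g -> df = dg ->
  is_derive t (1 : R) f df -> is_derive t (1 : R) g dg.
Proof. by move=> /funext -> ->. Qed.

Lemma is_derive_unique (f : R -> R) (d d' t : R) :
  is_derive t (1 : R) f d -> is_derive t (1 : R) f d' -> d = d'.
Proof. by move=> H1 H2; rewrite -(@derive_val _ _ _ _ _ _ _ H1) (@derive_val _ _ _ _ _ _ _ H2). Qed.

Lemma is_mx_derive_unique p q t (F : R -> 'M[C]_(p, q)) D D' :
  is_mx_derive t F D -> is_mx_derive t F D' -> D = D'.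
Proof.
move=> H H'; apply/matrixP => i j; apply/eqP; rewrite eq_complex.
have [a b] := H i j; have [a' b'] := H' i j.
by rewrite (is_derive_unique a a') (is_derive_unique b b') !eqxx.
Qed.

Lemma is_mx_derive_cst p q t (A : 'M[C]_(p, q)) : is_mx_derive t (fun=> A) 0.
Proof. by move=> i j; rewrite mxE; split; exact: is_derive_cst. Qed.

Lemma is_mx_derive_affine p q t (A B : 'M[C]_(p, q)) :
  is_mx_derive t (fun s => A + s%:C *: B) B.
Proof.
move=> i j; split.
  apply: (@is_derive_feq (fun s => Re (A i j) + s * Re (B i j)) _ (0 + (t * 0 + 1 * Re (B i j)))).
  - by move=> s; rewrite !mxE creD creM /=; ring.
  - by ring.
  by apply: is_derive_fD; apply: is_derive_fM.
apply: (@is_derive_feq (fun s => Im (A i j) + s * Im (B i j)) _ (0 + (t * 0 + 1 * Im (B i j)))).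
- by move=> s; rewrite !mxE cimD cimM /=; ring.
- by ring.
by apply: is_derive_fD; apply: is_derive_fM.
Qed.

Lemma is_mx_deriveM p q s t (F : R -> 'M[C]_(p, q)) (G : R -> 'M[C]_(q, s)) F' G' :
  is_mx_derive t F F' -> is_mx_derive t G G' ->
  is_mx_derive t (fun u => F u *m G u) (F t *m G' + F' *m G t).
Proof.
move=> HF HG i j; split.
  apply: (@is_derive_feq 
    (fun u => \sum_k (Re (F u i k) * Re (G u k j) - Im (F u i k) * Im (G u k j))) _
     (\sum_k ((Re (F t i k) * Re (G' k j) + Re (F' i k) * Re (G t k j)) -
      (Im (F t i k) * Im (G' k j) + Im (F' i k) * Im (G t k j))))).
  - by move=> u; rewrite mxE cre_sum; apply: eq_bigr => k _; rewrite creM.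
  - rewrite !mxE creD !cre_sum -big_split; apply: eq_bigr => k _.
    by rewrite /= !creM; ring.
  apply: is_derive_fsum => k; apply: is_derive_fB; apply: is_derive_fM;
    [exact: (HF _ _).1 | exact: (HG _ _).1 | exact: (HF _ _).2 | exact: (HG _ _).2].
apply: (@is_derive_feq 
  (fun u => \sum_k (Re (F u i k) * Im (G u k j) + Im (F u i k) * Re (G u k j))) _
   (\sum_k ((Re (F t i k) * Im (G' k j) + Re (F' i k) * Im (G t k j)) +
    (Im (F t i k) * Re (G' k j) + Im (F' i k) * Re (G t k j))))).
- by move=> u; rewrite mxE cim_sum; apply: eq_bigr => k _; rewrite cimM.
- rewrite !mxE cimD !cim_sum -big_split; apply: eq_bigr => k _.
  by rewrite /= !cimM; ring.
apply: is_derive_fsum => k; apply: is_derive_fD; apply: is_derive_fM;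
  [exact: (HF _ _).1 | exact: (HG _ _).2 | exact: (HF _ _).2 | exact: (HG _ _).1].
Qed.

Lemma is_mx_derive_sum n p q t (F : 'I_n -> R -> 'M[C]_(p, q)) F' :
  (forall l, is_mx_derive t (F l) (F' l)) ->
  is_mx_derive t (fun u => \sum_l F l u) (\sum_l F' l).
Proof.
move=> HF i j; split.
  apply: (@is_derive_feq (fun u => \sum_l Re (F l u i j)) _ (\sum_l Re (F' l i j))).
  - by move=> u; rewrite summxE cre_sum.
  - by rewrite summxE cre_sum.
  by apply: is_derive_fsum => l; exact: (HF _ _ _).1.
apply: (@is_derive_feq (fun u => \sum_l Im (F l u i j)) _ (\sum_l Im (F' l i j))).
- by move=> u; rewrite summxE cim_sum.
- by rewrite summxE cim_sum.
by apply: is_derive_fsum => l; exact: (HF _ _ _).2.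
Qed.

Lemma is_mx_derive_adj p q t (F : R -> 'M[C]_(p, q)) F' :
  is_mx_derive t F F' -> is_mx_derive t (fun u => (F u) ^t* ) (F' ^t* ).
Proof.
move=> HF i j; have [Hr Hi] := HF j i; split.
  by apply: is_derive_feq Hr => [u|]; rewrite !mxE cre_conj.
apply: (@is_derive_feq (fun u => 0 - Im (F u j i)) _ (0 - Im (F' j i))).
- by move=> u; rewrite !mxE cim_conj sub0r.
- by rewrite !mxE cim_conj sub0r.
Qed.

Lemma is_derive_mxdot p q t (X : 'M[C]_(p, q)) (F : R -> 'M[C]_(p, q)) F' :
  is_mx_derive t F F' -> is_derive t (1 : R) (fun u => mxdot X (F u)) (mxdot X F').
Proof.
move=> HF.
apply: (@is_derive_feq 
  (fun u => \sum_i \sum_j (Re (X i j) * Re (F u i j) + Im (X i j) * Im (F u i j))) _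
  (\sum_i \sum_j ((Re (X i j) * Re (F' i j) + 0 * Re (F t i j)) +
    (Im (X i j) * Im (F' i j) + 0 * Im (F t i j))))).
- by move=> u; rewrite mxdotE.
- by rewrite mxdotE; do 2!apply: eq_bigr => ? _; ring.
apply: is_derive_fsum => i; apply: is_derive_fsum => j.
have [Hr Hi] := HF i j.
by apply: is_derive_fD; apply: is_derive_fM.
Qed.

Lemma mean_value01 (f df : R -> R) : (forall t : R, is_derive t (1 : R) f (df t)) ->
  exists2 c, 0 <= c <= 1 & f 1 - f 0 = df c.
Proof.
move=> Hf; have [|c c01 ->] := @MVT_segment _ f df 0 1 ler01.
  by apply: derivable_within_continuous => x _; exact: (@ex_derive _ _ _ _ _ _ _ (Hf x)).
exists c; first by move: c01; rewrite in_itv.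
by rewrite subr0 mulr1.
Qed.

Lemma mx_analytic_entries p q p' q' (F : R -> 'M[C]_(p, q)) (G : R -> 'M[C]_(p', q'))
    (f : 'I_p' -> 'I_p) (g : 'I_q' -> 'I_q) :
  (forall t i j, G t i j = F t (f i) (g j)) -> mx_analytic F -> mx_analytic G.
Proof.
move=> GF FA i j; have [FR FI] := FA (f i) (g j); split.
  have -> // : (fun t => Re (G t i j)) = (fun t => Re (F t (f i) (g j))).
  by apply/funext => t; rewrite GF.
have -> // : (fun t => Im (G t i j)) = (fun t => Im (F t (f i) (g j))).
by apply/funext => t; rewrite GF.
Qed.

Lemma mx_analytic_submxrow k p (r : 'I_k -> nat) (F : forall j, R -> 'M[C]_(p, r j)) j :
  mx_analytic (fun t => \mxrow_j F j t) -> mx_analytic (F j).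
Proof.
apply: (@mx_analytic_entries _ _ _ _ _ _ id (tagnat.Rank j)) => t a b.
by have /matrixP/(_ a b) := mxrowK (fun j => F j t) j; rewrite mxE.
Qed.

Lemma mx_analytic_lsubmx p q q' (F : R -> 'M[C]_(p, q)) (G : R -> 'M[C]_(p, q')) :
  mx_analytic (fun t => row_mx (F t) (G t)) -> mx_analytic F.
Proof.
by apply: (@mx_analytic_entries _ _ _ _ _ _ id (lshift q')) => t a b; rewrite row_mxEl.
Qed.

Lemma mx_analytic_rsubmx p q q' (F : R -> 'M[C]_(p, q)) (G : R -> 'M[C]_(p, q')) :
  mx_analytic (fun t => row_mx (F t) (G t)) -> mx_analytic G.
Proof.
by apply: (@mx_analytic_entries _ _ _ _ _ _ id (@rshift q q')) => t a b; rewrite row_mxEr.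
Qed.

End Calculus.

(** * Orthonormal block frames and the pointwise bound *)

Section Blocks.
Context {R : realType}.
Local Notation C := R[i].
Context {k : nat} {r : 'I_k -> nat}.

Lemma adj_mxrow p (U : forall j, 'M[C]_(p, r j)) :
  (\mxrow_j U j) ^t* = \mxcol_j ((U j) ^t* ).
Proof. by apply/matrixP => a b; rewrite !mxE. Qed.

Lemma mxrow_cogram p (U : forall j, 'M[C]_(p, r j)) :
  \mxrow_j U j *m (\mxrow_j U j) ^t* = \sum_j U j *m (U j) ^t*.
Proof. by rewrite adj_mxrow mul_mxrow_mxcol. Qed.

Lemma mxrow_gram p (U : forall j, 'M[C]_(p, r j)) :
  (\mxrow_j U j) ^t* *m \mxrow_j U j = 1%:M ->
  (forall j, (U j) ^t* *m U j = 1%:M) /\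
  (forall i j, i != j -> (U i) ^t* *m U j = 0).
Proof.
rewrite adj_mxrow mul_mxcol_mxrow -mxdiagZ => E.
have B i j : (U i) ^t* *m U j = if i == j then conform_mx 0 (1%:M : 'M[C]_(r i)) else 0.
  have := congr1 (fun X => submxblock X i j) E.
  by rewrite mxblockK => ->; rewrite mxblockK.
split=> [j|i j ij]; first by rewrite B eqxx conform_mx_id.
by rewrite B (negPf ij).
Qed.

Lemma unitary_row_mx p q (U : forall j, 'M[C]_(p, r j)) (U' : 'M[C]_(p, q)) :
  unitary (row_mx (\mxrow_j U j) U') ->
  [/\ (forall j, (U j) ^t* *m U j = 1%:M),
      (forall i j, i != j -> (U i) ^t* *m U j = 0),
      (forall j, U' ^t* *m U j = 0),
      U' ^t* *m U' = 1%:M &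
      \sum_j U j *m (U j) ^t* + U' *m U' ^t* = 1%:M].
Proof.
move=> [E1 E2].
have adjE : (row_mx (\mxrow_j U j) U') ^t* = col_mx ((\mxrow_j U j) ^t* ) (U' ^t* ).
  by rewrite tr_row_mx map_col_mx.
move: E1 E2; rewrite adjE mul_col_row mul_row_col mxrow_cogram.
rewrite scalar_mx_block => /eq_block_mx[].
move=> /mxrow_gram[U1 U0] _ U'U U'1 E2; split => // j.
by rewrite -[LHS](mxrowK (fun j => U' ^t* *m U j)) -mul_mxrow U'U submxrow0.
Qed.

Lemma frob2_0 p q : frob2 (0 : 'M[C]_(p, q)) = 0.
Proof. by rewrite /frob2 /mxdot mulmx0 mxtrace0. Qed.

Lemma frob2_no_rows p q (X : 'M[C]_(p, q)) : p = 0%N -> frob2 X = 0.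
Proof. by move=> p0; subst p; rewrite frob2E big_ord0. Qed.

Section Pointwise.
Context {m n e : nat}.
(** Time is fixed here, and the primed matrices stand for derivatives at that time. *)
Context (W W' : forall j, 'M[C]_(m, r j)) (Wl Wl' : 'M[C]_(m, e)).
Context (V V' : forall j, 'M[C]_(n, r j)) (S S' : forall j, 'M[C]_(r j)).
Context (dB : 'M[C]_(m, n)) (a c : 'I_k -> R) (s : R).
Context (oW1 : forall j, (W j) ^t* *m W j = 1%:M).
Context (oW0 : forall i j, i != j -> (W i) ^t* *m W j = 0).
Context (oWl : forall j, Wl ^t* *m W j = 0).
Context (cW : \sum_j W j *m (W j) ^t* + Wl *m Wl ^t* = 1%:M).
Context (oV1 : forall j, (V j) ^t* *m V j = 1%:M).
Context (oV0 : forall i j, i != j -> (V i) ^t* *m V j = 0).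
Context (cV : \sum_j V j *m (V j) ^t* = 1%:M).
Context (dBE : dB = \sum_j (W j *m S j *m (V' j) ^t* +
                           (W j *m S' j + W' j *m S j) *m (V j) ^t* )).
Context (skW : forall i j, (W i) ^t* *m W' j + (W' i) ^t* *m W j = 0).
Context (skWl : forall j, Wl ^t* *m W' j + Wl' ^t* *m W j = 0).
Context (skV : forall i j, (V i) ^t* *m V' j + (V' i) ^t* *m V j = 0).
Context (hW : forall j, (W j) ^t* *m W' j = 0) (hWl : Wl ^t* *m Wl' = 0).
Context (hV : forall j, (V j) ^t* *m V' j = 0).
Context (a0 : forall j, 0 <= a j) (c0 : forall j, 0 <= c j).
Context (aS : forall i j, i != j -> forall x y, x \in singular_values (S j) ->
  y \in singular_values (S i) -> a j <= `|x - y|).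
Context (cS : forall i j, i != j -> forall x y, x \in singular_values (S j) ->
  y \in singular_values (S i) -> c j <= `|x - y|).
Context (lS : forall j, 2^-1 * a j ^+ 2 * frob2 (Wl ^t* *m W' j) +
  2^-1 * s ^+ 2 * frob2 (Wl ^t* *m W' j) <= frob2 (Wl ^t* *m W' j *m S j)).

Let K i j := (W i) ^t* *m W' j.
Let L i j := (V i) ^t* *m V' j.
Let E i j := frob2 (K i j *m S j - S i *m L i j).

(** Only two terms of the sum [dB] survive between [W i] and [V j]: [l = i], where the derivative
    falls on [V], and [l = j], where it falls on [W]; the derivative of [S] appears when
    [i = j]. *)
Lemma upper_block i j : frob2 ((W i) ^t* *m dB *m V j) =
  E i j + (if i == j then frob2 (S' j) else 0).
Proof.
have term l : (W i) ^t* *m (W l *m S l *m (V' l) ^t* +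
      (W l *m S' l + W' l *m S l) *m (V l) ^t* ) *m V j =
    ((W i) ^t* *m W l) *m (S l *m ((V' l) ^t* *m V j)) +
    ((W i) ^t* *m W l) *m S' l *m ((V l) ^t* *m V j) +
    K i l *m S l *m ((V l) ^t* *m V j).
  by rewrite mulmxDr mulmxDl mulmxDl mulmxDr mulmxDl /K !mulmxA addrA.
have VV l : (V' l) ^t* *m V j = - L l j.
  by apply/eqP; rewrite -addr_eq0 addrC skV.
rewrite dBE mulmx_sumr mulmx_suml.
have -> : \sum_l ((W i) ^t* *m (W l *m S l *m (V' l) ^t* +
      (W l *m S' l + W' l *m S l) *m (V l) ^t* ) *m V j) =
    - (S i *m L i j) + (\sum_l ((W i) ^t* *m W l) *m S' l *m ((V l) ^t* *m V j)) + K i j *m S j.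
  rewrite (eq_bigr _ (fun l _ => term l)) !big_split /=; congr (_ + _ + _).
    rewrite (bigD1 i) //= big1 ?addr0 => [|l li].
      by rewrite oW1 mul1mx VV mulmxN.
    by rewrite oW0 ?mul0mx // eq_sym.
  rewrite (bigD1 j) //= big1 ?addr0 => [|l lj]; first by rewrite oV1 mulmx1.
  by rewrite (oV0 lj) mulmx0.
rewrite /E; case: eqP => [ij|/eqP ij].
  subst j; rewrite (bigD1 i) //= big1 ?addr0 => [|l li]; last first.
    by rewrite (oV0 li) mulmx0.
  have -> : K i i = 0 by exact: hW.
  have -> : L i i = 0 by exact: hV.
  by rewrite oW1 oV1 mul1mx mulmx1 mulmx0 mul0mx oppr0 !add0r !addr0 frob2_0 add0r.
rewrite big1 ?addr0 => [|l _]; last first.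
  have [<-|il] := eqVneq i l; first by rewrite (oV0 ij) mulmx0.
  by rewrite oW0 // !mul0mx.
by rewrite addrC.
Qed.

Lemma lower_block j : Wl ^t* *m dB *m V j = Wl ^t* *m W' j *m S j.
Proof.
rewrite dBE mulmx_sumr mulmx_suml (bigD1 j) //= big1 ?addr0 => [|l lj].
  rewrite mulmxDr mulmxDl mulmxDl mulmxDr mulmxDl !mulmxA oWl !mul0mx !add0r.
  by rewrite -(mulmxA _ (_ ^t* )) oV1 mulmx1.
rewrite mulmxDr mulmxDl mulmxDl mulmxDr mulmxDl !mulmxA oWl !mul0mx !add0r.
by rewrite -(mulmxA _ (_ ^t* )) (oV0 lj) mulmx0.
Qed.

Lemma frob2_dB : frob2 dB =
  \sum_j frob2 (S' j) + \sum_j \sum_i E i j + \sum_j frob2 (Wl ^t* *m W' j *m S j).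
Proof.
rewrite (frob2_sum_l dB cW) (frob2_sum_r _ cV); congr (_ + _); last first.
  by apply: eq_bigr => j _; rewrite lower_block.
under eq_bigr => i _ do rewrite (frob2_sum_r _ cV).
rewrite exchange_big -big_split; apply: eq_bigr => j _ /=.
under eq_bigr => i _ do rewrite upper_block.
by rewrite big_split /= -big_mkcond big_pred1_eq addrC.
Qed.

Lemma frob2_W' j : frob2 (W' j) = \sum_i frob2 (K i j) + frob2 (Wl ^t* *m W' j).
Proof. exact: frob2_sum_l cW. Qed.

Lemma frob2_V' j : frob2 (V' j) = \sum_i frob2 (L i j).
Proof.
rewrite (@frob2_sum_l _ _ _ _ _ 0 V 0) ?mul0mx ?addr0 // [X in _ + X]frob2_no_rows ?addr0 //.
Qed.

Lemma frob2_Wl' : frob2 Wl' = \sum_j frob2 (Wl ^t* *m W' j).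
Proof.
rewrite (frob2_sum_l Wl' cW) hWl [X in _ + X](_ : _ = 0) ?addr0; last exact: frob2_0.
apply: eq_bigr => j _.
have -> : Wl ^t* *m W' j = - (Wl' ^t* *m W j) by apply/eqP; rewrite -addr_eq0 skWl.
by rewrite frob2N -frob2_adj adjM trmxCK.
Qed.

(** Skew-Hermitian symmetry rewrites the block (j, i) in terms of [K i j] and [L i j].  The weights
    [a j] and [c j] may differ, so the gap estimate is used for the larger one. *)
Lemma pair_block i j :
  a j ^+ 2 * frob2 (K i j) + c j ^+ 2 * frob2 (L i j) <= E i j + E j i.
Proof.
have [->|ij] := eqVneq i j.
  have -> : K j j = 0 by exact: hW.
  have -> : L j j = 0 by exact: hV.
  by rewrite !frob2_0 !mulr0 addr0 addr_ge0 ?frob2_ge0.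
have EE : E j i = frob2 ((S i) ^t* *m K i j - L i j *m (S j) ^t* ).
  rewrite /E -frob2_adj -frob2N adjB (adjM (K j i)) (adjM (S j)).
  have -> : (K j i) ^t* = - K i j.
    by rewrite /K adjM trmxCK; apply/eqP; rewrite -addr_eq0 addrC skW.
  have -> : (L j i) ^t* = - L i j.
    by rewrite /L adjM trmxCK; apply/eqP; rewrite -addr_eq0 addrC skV.
  by rewrite mulmxN mulNmx opprK opprD opprK.
rewrite EE; pose g := Num.max (a j) (c j).
have g0 : 0 <= g by rewrite le_max a0.
apply: (@le_trans _ _ (g ^+ 2 * (frob2 (K i j) + frob2 (L i j)))).
  rewrite mulrDr lerD // ler_wpM2r ?frob2_ge0 // ler_sqr ?nnegrE // le_max lexx ?orbT //.
apply: sv_gap_pair => // x y xi yj; rewrite ge_max distrC.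
by rewrite (aS ij) // (cS ij).
Qed.

(** The factor 1/2 comes from counting every block twice: [K i j] in the speed of [W j] and, up to
    an adjoint, in that of [W i], and [Wl^H W' j] in the speeds of [W j] and of [Wl]. *)
Lemma pointwise_bound :
  \sum_j frob2 (S' j) + \sum_j 2^-1 * a j ^+ 2 * frob2 (W' j)
  + 2^-1 * s ^+ 2 * frob2 Wl' + \sum_j 2^-1 * c j ^+ 2 * frob2 (V' j) <= frob2 dB.
Proof.
rewrite frob2_dB -!addrA lerD2l.
have EE : \sum_j \sum_i E i j = \sum_j \sum_i 2^-1 * (E i j + E j i).
  under [RHS]eq_bigr => j _ do (rewrite -mulr_sumr big_split /=).
  by rewrite -mulr_sumr big_split /= [X in _ + X]exchange_big /=; field.
apply: (@le_trans _ _ (\sum_j \sum_i 2^-1 * (a j ^+ 2 * frob2 (K i j) + c j ^+ 2 * frob2 (L i j))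
    + \sum_j (2^-1 * a j ^+ 2 * frob2 (Wl ^t* *m W' j) +
              2^-1 * s ^+ 2 * frob2 (Wl ^t* *m W' j)))); last first.
  apply: lerD; last by apply: ler_sum => j _; exact: lS.
  rewrite EE; apply: ler_sum => j _; apply: ler_sum => i _.
  by rewrite ler_pM2l ?invr_gt0 // pair_block.
rewrite le_eqVlt; apply/orP; left; apply/eqP.
rewrite frob2_Wl' mulr_sumr -!big_split; apply: eq_bigr => j _ /=.
rewrite frob2_W' frob2_V' -mulr_sumr big_split /= -!mulr_sumr; ring.
Qed.

End Pointwise.
End Blocks.

(** * Integration along the path *)

Lemma gram_unitary_equiv (R : realType) p q s (P : 'M[R[i]]_(p, q)) (S : 'M[R[i]]_(q, s))
    (Q : 'M[R[i]]_s) : P ^t* *m P = 1%:M ->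
  (P *m S *m Q ^t* ) ^t* *m (P *m S *m Q ^t* ) = Q *m (S ^t* *m S) *m Q ^t*.
Proof.
by move=> PP; rewrite !adjM trmxCK -!mulmxA (mulmxA (P ^t* ) P) PP mul1mx.
Qed.

Section Path.
Import numFieldNormedType.Exports.
Context {R : realType}.
Local Notation C := R[i].
Context (m k : nat) (r : 'I_k -> nat).
Local Notation n := (\sum_j r j)%N.
Context (B dB : 'M[C]_(m, n)) (Sigma : forall j, R -> 'M[C]_(r j)).
Context (W : forall j, R -> 'M[C]_(m, r j)) (Wlast : R -> 'M[C]_(m, m - n)).
Context (V : forall j, R -> 'M[C]_(n, r j)).
Context (Sigma_analytic : forall j, mx_analytic (Sigma j)).
Context (W_analytic : mx_analytic (fun t => row_mx (\mxrow_j W j t) (Wlast t))).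
Context (V_analytic : mx_analytic (fun t => \mxrow_j V j t)).
Context (W_unitary : forall t, unitary (row_mx (\mxrow_j W j t) (Wlast t))).
Context (V_unitary : forall t, unitary (\mxrow_j V j t)).
Context (decomp : forall t : R, B + t%:C *: dB =
  row_mx (\mxrow_j W j t) (Wlast t) *m col_mx (\mxdiag_j Sigma j t) 0 *m (\mxrow_j V j t) ^t* ).
Context (W_derive : forall j t, (W j t) ^t* *m mx_derive (W j) t = 0).
Context (Wlast_derive : forall t, (Wlast t) ^t* *m mx_derive Wlast t = 0).
Context (V_derive : forall j t, (V j t) ^t* *m mx_derive (V j) t = 0).

Lemma is_mx_derive_Sigma j t : is_mx_derive t (Sigma j) (mx_derive (Sigma j) t).
Proof. exact: mx_analytic_derive. Qed.

Lemma is_mx_derive_V j t : is_mx_derive t (V j) (mx_derive (V j) t).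
Proof. by apply: mx_analytic_derive; apply: mx_analytic_submxrow; exact: V_analytic. Qed.

Lemma is_mx_derive_W j t : is_mx_derive t (W j) (mx_derive (W j) t).
Proof.
by apply: mx_analytic_derive; apply: mx_analytic_submxrow; exact: mx_analytic_lsubmx W_analytic.
Qed.

Lemma is_mx_derive_Wlast t : is_mx_derive t Wlast (mx_derive Wlast t).
Proof. by apply: mx_analytic_derive; exact: mx_analytic_rsubmx W_analytic. Qed.

Arguments is_mx_derive_Sigma : clear implicits.
Arguments is_mx_derive_V : clear implicits.
Arguments is_mx_derive_W : clear implicits.

Lemma orthonormal_V t :
  [/\ (forall j, (V j t) ^t* *m V j t = 1%:M),
      (forall i j, i != j -> (V i t) ^t* *m V j t = 0) &
      \sum_j V j t *m (V j t) ^t* = 1%:M].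
Proof.
have [V1 V2] := V_unitary t.
have [V10 V00] := mxrow_gram V1; split=> //.
by rewrite -mxrow_cogram.
Qed.

Lemma decomp_sum t : B + t%:C *: dB = \sum_j W j t *m Sigma j t *m (V j t) ^t*.
Proof.
by rewrite decomp mul_row_col mulmx0 addr0 mul_mxrow_mxdiag adj_mxrow mul_mxrow_mxcol.
Qed.

Lemma singular_values_path t :
  singular_values (B + t%:C *: dB) = singular_values (\mxdiag_j Sigma j t).
Proof.
have [V1 V2] := V_unitary t; have [W1 _] := W_unitary t.
apply: (@singular_values_unitary _ _ _ _ _ _ (\mxrow_j V j t)).
  by apply/unitarymxP; exact: V2.
have SS : (col_mx (\mxdiag_j Sigma j t) (0 : 'M[C]_(m - n, n))) ^t* *m
    col_mx (\mxdiag_j Sigma j t) 0 = (\mxdiag_j Sigma j t) ^t* *m \mxdiag_j Sigma j t.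
  by rewrite tr_col_mx map_row_mx mul_row_col mulmx0 addr0.
by rewrite decomp (gram_unitary_equiv _ _ W1) SS.
Qed.

(** Applied to the orthonormality relations between the blocks of a frame. *)
Lemma skew_of_constant p q s t (F : R -> 'M[C]_(p, q)) (G : R -> 'M[C]_(p, s)) F' G' A :
  is_mx_derive t F F' -> is_mx_derive t G G' ->
  (forall u, (F u) ^t* *m G u = A) -> (F t) ^t* *m G' + F' ^t* *m G t = 0.
Proof.
move=> HF HG FG; have H := is_mx_deriveM (is_mx_derive_adj HF) HG.
apply: is_mx_derive_unique H _.
have -> : (fun u => (F u) ^t* *m G u) = fun=> A by apply/funext.
exact: is_mx_derive_cst.
Qed.

(** The weights must lie below the singular values because [Wlast^H W_j'] is only seen multiplied
    by [Sigma_j]; for square matrices [Wlast] has no columns and this block is void. *)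
Lemma path_bound t (a c : 'I_k -> R) (s : R) :
  (forall j, 0 <= a j) -> (forall j, 0 <= c j) ->
  (forall i j, i != j -> forall x y, x \in singular_values (Sigma j t) ->
    y \in singular_values (Sigma i t) -> a j <= `|x - y|) ->
  (forall i j, i != j -> forall x y, x \in singular_values (Sigma j t) ->
    y \in singular_values (Sigma i t) -> c j <= `|x - y|) ->
  (m - n = 0)%N \/
    (0 <= s /\ forall j x, x \in singular_values (Sigma j t) -> a j <= x /\ s <= x) ->
  \sum_j frob2 (mx_derive (Sigma j) t)
  + \sum_j 2^-1 * a j ^+ 2 * frob2 (mx_derive (W j) t)
  + 2^-1 * s ^+ 2 * frob2 (mx_derive Wlast t)
  + \sum_j 2^-1 * c j ^+ 2 * frob2 (mx_derive (V j) t) <= frob2 dB.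
Proof.
move=> a0 c0 aS cS lS.
have [oW1 oW0 oWl _ cW] := unitary_row_mx (W_unitary t).
have [oV1 oV0 cV] := orthonormal_V t.
apply: (pointwise_bound oW1 oW0 oWl cW oV1 oV0 cV) => //.
- have H := is_mx_derive_affine t B dB; apply: is_mx_derive_unique H _.
  have -> : (fun u => B + u%:C *: dB) = fun u => \sum_j W j u *m Sigma j u *m (V j u) ^t*.
    by apply/funext => u; exact: decomp_sum.
  apply: is_mx_derive_sum => j.
  have HWS := is_mx_deriveM (is_mx_derive_W j t) (is_mx_derive_Sigma j t).
  exact: is_mx_deriveM HWS (is_mx_derive_adj (is_mx_derive_V j t)).
- move=> i j; have [ij|ij] := eqVneq i j.
    subst j; apply: (skew_of_constant (A := 1%:M) (is_mx_derive_W i t) (is_mx_derive_W i t)) => u.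
    by have [] := unitary_row_mx (W_unitary u).
  apply: (skew_of_constant (A := 0) (is_mx_derive_W i t) (is_mx_derive_W j t)) => u.
  by have [_ o0 _ _ _] := unitary_row_mx (W_unitary u); exact: o0.
- move=> j; apply: (skew_of_constant (A := 0) (is_mx_derive_Wlast t) (is_mx_derive_W j t)) => u.
  by have [_ _ ol _ _] := unitary_row_mx (W_unitary u); exact: ol.
- move=> i j; have [ij|ij] := eqVneq i j.
    subst j; apply: (skew_of_constant (A := 1%:M) (is_mx_derive_V i t) (is_mx_derive_V i t)) => u.
    by have [ o1 _ _] := orthonormal_V u; exact: o1.
  apply: (skew_of_constant (A := 0) (is_mx_derive_V i t) (is_mx_derive_V j t)) => u.
  by have [_ o0 _] := orthonormal_V u; exact: o0.
- exact: aS.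
- exact: cS.
- move=> j; case: lS => [mn0|[s0 aSj]].
    by rewrite !frob2_no_rows // !mulr0 addr0.
  rewrite -!mulrA -mulrDr ler_pdivrMl // mulr_natl mulr2n.
  have a_le : a j ^+ 2 * frob2 ((Wlast t) ^t* *m mx_derive (W j) t) <=
      frob2 ((Wlast t) ^t* *m mx_derive (W j) t *m Sigma j t).
    by apply: sv_gap_mulr => // x /aSj[].
  have s_le : s ^+ 2 * frob2 ((Wlast t) ^t* *m mx_derive (W j) t) <=
      frob2 ((Wlast t) ^t* *m mx_derive (W j) t *m Sigma j t).
    by apply: sv_gap_mulr => // x /aSj[].
  by rewrite !mulrA -!expr2; exact: lerD.
Qed.

(** With N the weighted sum of squared displacements D_X, the function
    [val t = \sum_X w_X <D_X, X(t)>] satisfies [val 1 - val 0 = N], while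
    [2 val'(t) <= \sum_X w_X (|D_X|^2 + |X'(t)|^2) <= N + |dB|^2].  The mean value theorem gives
    [2 N <= N + |dB|^2]. *)
Lemma integrated_bound (a c : 'I_k -> R) (s : R) :
  (forall j, 0 <= a j) -> (forall j, 0 <= c j) ->
  (forall t, 0 <= t <= 1 -> forall i j, i != j -> forall x y, x \in singular_values (Sigma j t) ->
    y \in singular_values (Sigma i t) -> a j <= `|x - y|) ->
  (forall t, 0 <= t <= 1 -> forall i j, i != j -> forall x y, x \in singular_values (Sigma j t) ->
    y \in singular_values (Sigma i t) -> c j <= `|x - y|) ->
  (m - n = 0)%N \/ (0 <= s /\ forall t, 0 <= t <= 1 -> forall j x,
     x \in singular_values (Sigma j t) -> a j <= x /\ s <= x) ->
  frob2 (Sing (B + dB) - Sing B)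
  + \sum_j 2^-1 * a j ^+ 2 * frob2 (W j 1 - W j 0)
  + 2^-1 * s ^+ 2 * frob2 (Wlast 1 - Wlast 0)
  + \sum_j 2^-1 * c j ^+ 2 * frob2 (V j 1 - V j 0) <= frob2 dB.
Proof.
move=> a0 c0 aS cS lS.
have SE t : Sing (B + t%:C *: dB) = Sing (\mxdiag_j Sigma j t).
  by rewrite /Sing singular_values_path.
have sing_le : frob2 (Sing (B + dB) - Sing B) <= \sum_j frob2 (Sigma j 1 - Sigma j 0).
  have -> : Sing B = Sing (\mxdiag_j Sigma j 0) by rewrite -SE scale0r addr0.
  have -> : Sing (B + dB) = Sing (\mxdiag_j Sigma j 1) by rewrite -SE scale1r.
  by apply: le_trans (mirsky _ _) _; rewrite -mxdiagB frob2_mxdiag.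
apply: (@le_trans _ _ (\sum_j frob2 (Sigma j 1 - Sigma j 0)
  + \sum_j 2^-1 * a j ^+ 2 * frob2 (W j 1 - W j 0)
  + 2^-1 * s ^+ 2 * frob2 (Wlast 1 - Wlast 0)
  + \sum_j 2^-1 * c j ^+ 2 * frob2 (V j 1 - V j 0))); first by rewrite !lerD2r.
set N := (X in X <= _).
(* The same weighted sum serves for the function, with the values X(t), and for its derivative. *)
pose phi (f : forall p q, 'M[C]_(p, q) -> (R -> 'M[C]_(p, q)) -> R) :=
  \sum_j f _ _ (Sigma j 1 - Sigma j 0) (Sigma j)
  + \sum_j 2^-1 * a j ^+ 2 * f _ _ (W j 1 - W j 0) (W j)
  + 2^-1 * s ^+ 2 * f _ _ (Wlast 1 - Wlast 0) Wlast
  + \sum_j 2^-1 * c j ^+ 2 * f _ _ (V j 1 - V j 0) (V j).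
pose val t := phi (fun p q X F => mxdot X (F t)).
pose der t := phi (fun p q X F => mxdot X (mx_derive F t)).
have scaleD p q w t (X : 'M[C]_(p, q)) F : is_mx_derive t F (mx_derive F t) ->
    is_derive t (1 : R) (fun u => w * mxdot X (F u)) (w * mxdot X (mx_derive F t)).
  move=> HF; apply: (@is_derive_feq _ (fun u => w * mxdot X (F u)) _
    (w * mxdot X (mx_derive F t) + 0 * mxdot X (F t))) => //.
    by rewrite mul0r addr0.
  apply: is_derive_fM; exact: is_derive_mxdot.
have valD t : is_derive t (1 : R) val (der t).
  apply: is_derive_fD; [apply: is_derive_fD; [apply: is_derive_fD|]|].
  - by apply: is_derive_fsum => j; apply: is_derive_mxdot; exact: is_mx_derive_Sigma.
  - by apply: is_derive_fsum => j; apply: scaleD; exact: is_mx_derive_W.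
  - by apply: scaleD; exact: is_mx_derive_Wlast.
  - by apply: is_derive_fsum => j; apply: scaleD; exact: is_mx_derive_V.
have [t t01 valE] := mean_value01 valD.
have NE : N = val 1 - val 0.
  have dotB p q w (F : R -> 'M[C]_(p, q)) : w * frob2 (F 1 - F 0) =
      w * mxdot (F 1 - F 0) (F 1) - w * mxdot (F 1 - F 0) (F 0).
    by rewrite -mulrBr -mxdotB.
  have sumB (f g h : 'I_k -> R) : (forall j, h j = f j - g j) ->
      \sum_j h j = \sum_j f j - \sum_j g j.
    by move=> e; rewrite -sumrB; exact: eq_bigr.
  have split4 (x1 x2 x3 x4 y1 y2 y3 y4 : R) : x1 + x2 + x3 + x4 - (y1 + y2 + y3 + y4) =
      (x1 - y1) + (x2 - y2) + (x3 - y3) + (x4 - y4) by ring.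
  rewrite /N /val /phi split4; congr (_ + _ + _ + _).
  - by apply: sumB => j; exact: mxdotB.
  - by apply: sumB => j; exact: dotB.
  - exact: dotB.
  - by apply: sumB => j; exact: dotB.
have young p q w (X Y : 'M[C]_(p, q)) : 0 <= w -> 2 * (w * mxdot X Y) <= w * frob2 X + w * frob2 Y.
  by move=> w0; rewrite mulrCA -mulrDr ler_wpM2l // mxdot_le.
have le2 : 2 * der t <= N + frob2 dB.
  have lSt : (m - n = 0)%N \/
      (0 <= s /\ forall j x, x \in singular_values (Sigma j t) -> a j <= x /\ s <= x).
    by case: lS => [|[s0 h]]; [left|right; split=> //; exact: h].
  apply: (le_trans _ (lerD (lexx N) (path_bound a0 c0 (aS t t01) (cS t t01) lSt))).
  have half0 x : 0 <= 2^-1 * x ^+ 2 :> R by rewrite mulr_ge0 ?invr_ge0 ?sqr_ge0.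
  rewrite /der /phi /N !mulrDr [X in _ <= X]addrACA; apply: lerD; last first.
    by rewrite mulr_sumr -big_split; apply: ler_sum => j _; exact: young.
  rewrite [X in _ <= X]addrACA; apply: lerD; last exact: young.
  rewrite [X in _ <= X]addrACA; apply: lerD; last first.
    by rewrite mulr_sumr -big_split; apply: ler_sum => j _; exact: young.
  by rewrite mulr_sumr -big_split; apply: ler_sum => j _; exact: mxdot_le.
by move: le2; rewrite -valE -NE mulr_natl mulr2n lerD2l.
Qed.

Lemma frob2_const p q (F : R -> 'M[C]_(p, q)) :
  (forall t, is_mx_derive t F 0) -> frob2 (F 1 - F 0) = 0.
Proof.
move=> H; have [|t _] := @mean_value01 _ (fun u => mxdot (F 1 - F 0) (F u)) (fun=> 0).
  by move=> t; have := is_derive_mxdot (F 1 - F 0) (H t); rewrite /mxdot mulmx0 mxtrace0.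
by rewrite -mxdotB.
Qed.

(** A single block is a square unitary matrix, so [V^H V' = 0] gives [V' = 0]. *)
Lemma single_block_V j : (forall i, i = j) -> frob2 (V j 1 - V j 0) = 0.
Proof.
move=> one; apply: frob2_const => t; have := is_mx_derive_V j t.
suff -> : mx_derive (V j) t = 0 by [].
have [_ _ cVs] := orthonormal_V t.
have cV : V j t *m (V j t) ^t* = 1%:M.
  by rewrite -cVs [RHS](bigD1 j) //= [X in _ + X]big1 ?addr0 // => i; rewrite (one i) eqxx.
by rewrite -[LHS]mul1mx -cV -mulmxA V_derive mulmx0.
Qed.

Lemma single_block_W j : (m - n = 0)%N -> (forall i, i = j) -> frob2 (W j 1 - W j 0) = 0.
Proof.
move=> mn one; apply: frob2_const => t; have := is_mx_derive_W j t.
suff -> : mx_derive (W j) t = 0 by [].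
have [_ _ _ _ cWs] := unitary_row_mx (W_unitary t).
have Wl0 : Wlast t = 0.
  by apply: frob2_eq0; rewrite -frob2_adj frob2_no_rows.
have cW : W j t *m (W j t) ^t* = 1%:M.
  rewrite -cWs Wl0 mul0mx addr0 [RHS](bigD1 j) //= [X in _ + X]big1 ?addr0 // => i.
  by rewrite (one i) eqxx.
by rewrite -[LHS]mul1mx -cW -mulmxA W_derive mulmx0.
Qed.

End Path.

(** * Minima in the extended reals *)

Section Minima.
Context {R : realType}.
Local Open Scope ereal_scope.

Lemma bigmin_le (T : eqType) (l : seq T) (P : pred T) (f : T -> \bar R) x :
  x \in l -> P x -> \big[Order.min/+oo]_(y <- l | P y) f y <= f x.
Proof.
elim: l => // y l IH; rewrite inE => xl Px; rewrite big_cons.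
have [yx|yx] := eqVneq x y; first by rewrite -yx Px ge_min lexx.
move: xl; rewrite (negPf yx) => /IH/(_ Px) h.
by case: ifP => _ //; rewrite ge_min h orbT.
Qed.

Lemma bigmin_ge0 T (l : seq T) (P : pred T) (f : T -> \bar R) :
  (forall x, 0 <= f x) -> 0 <= \big[Order.min/+oo]_(y <- l | P y) f y.
Proof.
move=> f0; elim/big_ind: _ => // x y x0 y0; by rewrite le_min x0 y0.
Qed.

Lemma min01_le (f : R -> \bar R) t : (0 <= t <= 1)%R -> min01 f <= f t.
Proof. by move=> t01; apply: ereal_inf_lbound; exists t => //=; rewrite in_itv. Qed.

Lemma min01_ge0 (f : R -> \bar R) : (forall t, 0 <= f t) -> 0 <= min01 f.
Proof. by move=> f0; apply: le_ereal_inf_tmp => _ [t _ <-]; exact: f0. Qed.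

Lemma fine_le_of_le (x : \bar R) (y : R) : 0 <= x -> x <= y%:E -> (fine x <= y)%R.
Proof. by case: x => [x||] //=; rewrite ?lee_fin. Qed.

(** An infinite weight is harmless when it multiplies zero; the real weight 0, which is
    [fine +oo], then gives the same term. *)
Lemma weight_term (x : \bar R) (f : R) : 0 <= x -> (x = +oo -> f = 0%R) ->
  x ^+ 2 * 2^-1%:E * f%:E = (2^-1 * fine x ^+ 2 * f)%:E.
Proof.
case: x => [x||] // _ f0.
  by rewrite expe2 /= -!EFinM; congr (_%:E); ring.
by rewrite f0 // mule0 mulr0.
Qed.

End Minima.

Section GapBounds.
Context {R : realType} {k : nat} {r : 'I_k -> nat}.
Context (Sigma : forall j : 'I_k, R -> 'M[R[i]]_(r j)).
Context (r_gt0 : forall j : 'I_k, (0 < r j)%N).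

Lemma singular_value_ge0 p q (X : 'M[R[i]]_(p, q)) s : s \in singular_values X -> 0 <= s.
Proof. by move=> /(nthP 0)[l _ <-]; exact: singular_values_ge0. Qed.

Local Open Scope ereal_scope.

Lemma rho_ge0 j t : 0 <= rho Sigma j t.
Proof. by apply: bigmin_ge0 => i0; do 2!apply: bigmin_ge0 => ?; rewrite lee_fin. Qed.

Lemma sigma_block_ge0 j t : 0 <= sigma_block Sigma j t.
Proof.
rewrite /sigma_block big_seq; elim/big_ind: _ => // [x y x0 y0|s].
  by rewrite le_min x0 y0.
by move/singular_value_ge0; rewrite lee_fin.
Qed.

Lemma rho_min_ge0 j : 0 <= rho_min Sigma j.
Proof. by apply: min01_ge0 => t; exact: rho_ge0. Qed.

Lemma rho_hat_min_ge0 j : 0 <= rho_hat_min Sigma j.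
Proof. by apply: min01_ge0 => t; rewrite le_min rho_ge0 sigma_block_ge0. Qed.

Lemma sigma_min_ge0 : 0 <= sigma_min Sigma.
Proof. by apply: min01_ge0 => t; apply: bigmin_ge0 => j; exact: sigma_block_ge0. Qed.

Lemma rho_le j i t x y : i != j -> x \in singular_values (Sigma j t) ->
  y \in singular_values (Sigma i t) -> rho Sigma j t <= `|x - y|%R%:E.
Proof.
move=> ij xj yi; apply: le_trans (bigmin_le _ (mem_index_enum i) ij) _.
apply: le_trans (bigmin_le _ xj _) _ => //.
exact: (bigmin_le (P := xpredT) (fun y => `|x - y|%R%:E) yi).
Qed.

Lemma sigma_block_le j t x : x \in singular_values (Sigma j t) -> sigma_block Sigma j t <= x%:E.
Proof. by move=> xj; exact: (bigmin_le (P := xpredT) (fun y : R => y%:E) xj). Qed.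

Lemma rho_min_le j i t x y : (0 <= t <= 1)%R -> i != j ->
  x \in singular_values (Sigma j t) -> y \in singular_values (Sigma i t) ->
  rho_min Sigma j <= `|x - y|%R%:E.
Proof. by move=> t01 ij xj yi; apply: le_trans (min01_le _ t01) _; exact: rho_le xj yi. Qed.

Lemma rho_hat_min_le_rho j i t x y : (0 <= t <= 1)%R -> i != j ->
  x \in singular_values (Sigma j t) -> y \in singular_values (Sigma i t) ->
  rho_hat_min Sigma j <= `|x - y|%R%:E.
Proof.
move=> t01 ij xj yi; apply: le_trans (min01_le _ t01) _.
by rewrite ge_min (rho_le ij xj yi).
Qed.

Lemma rho_hat_min_le_sigma j t x : (0 <= t <= 1)%R -> x \in singular_values (Sigma j t) ->
  rho_hat_min Sigma j <= x%:E.
Proof.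
move=> t01 xj; apply: le_trans (min01_le _ t01) _.
by rewrite ge_min (sigma_block_le xj) orbT.
Qed.

Lemma sigma_min_le j t x : (0 <= t <= 1)%R -> x \in singular_values (Sigma j t) ->
  sigma_min Sigma <= x%:E.
Proof.
move=> t01 xj; apply: le_trans (min01_le _ t01) _.
by apply: le_trans (bigmin_le _ (mem_index_enum j) _) (sigma_block_le xj).
Qed.

Lemma singular_value_exists j t : exists s, s \in singular_values (Sigma j t).
Proof.
exists (nth 0%R (singular_values (Sigma j t)) 0).
by rewrite mem_nth // size_singular_values.
Qed.

(** Blocks have positive size, so a second block contributes an actual, finite gap. *)
Lemma rho_min_pinfty j : rho_min Sigma j = +oo -> forall i, i = j.
Proof.
move=> roo i; apply/eqP; apply: contraT => ij.
have [x xj] := singular_value_exists j 0; have [y yi] := singular_value_exists i 0.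
by have := rho_min_le (t := 0%R) _ ij xj yi; rewrite lexx ler01 roo leye_eq => /(_ isT).
Qed.

Lemma rho_hat_min_fin j : rho_hat_min Sigma j <> +oo.
Proof.
move=> roo; have [x xj] := singular_value_exists j 0.
by have := rho_hat_min_le_sigma (t := 0%R) _ xj; rewrite lexx ler01 roo leye_eq => /(_ isT).
Qed.

Lemma sigma_min_fin (k_gt0 : (0 < k)%N) : sigma_min Sigma <> +oo.
Proof.
move=> roo; have [x xj] := singular_value_exists (Ordinal k_gt0) 0.
by have := sigma_min_le (t := 0%R) _ xj; rewrite lexx ler01 roo leye_eq => /(_ isT).
Qed.

End GapBounds.

Theorem theorem3p1 (R : realType) (m n k : nat) (r : 'I_k -> nat)
  (le_nm : (n <= m)%N)
  (k_gt0 : (0 < k)%N)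
  (r_gt0 : forall j : 'I_k, (0 < r j)%N)
  (sum_r : (\sum_(j < k) r j)%N = n)
  (B dB : 'M[R[i]]_(m, n))
  (Sigma : forall j : 'I_k, R -> 'M[R[i]]_(r j))
  (W : forall j : 'I_k, R -> 'M[R[i]]_(m, r j))
  (Wlast : R -> 'M[R[i]]_(m, m - n))
  (V : forall j : 'I_k, R -> 'M[R[i]]_(n, r j))
  (Wfull := fun t : R => row_mx (\mxrow_(j < k) W j t) (Wlast t))
  (Vfull := fun t : R => \mxrow_(j < k) V j t)
  (Sigma_analytic : forall j : 'I_k, mx_analytic (Sigma j))
  (W_analytic : mx_analytic Wfull)
  (V_analytic : mx_analytic Vfull)
  (W_unitary : forall t : R, unitary (Wfull t))
  (V_unitary : forall t : R, unitary (Vfull t))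
  (decomp : forall t : R,
     B + t%:C *: dB =
     Wfull t *m col_mx (\mxdiag_(j < k) Sigma j t) 0 *m (Vfull t) ^t*)
  (W_derive : forall (j : 'I_k) (t : R), (W j t) ^t* *m mx_derive (W j) t = 0)
  (Wlast_derive : forall t : R, (Wlast t) ^t* *m mx_derive Wlast t = 0)
  (V_derive : forall (j : 'I_k) (t : R), (V j t) ^t* *m mx_derive (V j) t = 0) :
  ((frobenius (Sing (B + dB) - Sing B) ^+ 2)%:E
   + (\sum_(j < k) (rho_hat_min Sigma j ^+ 2 * 2^-1%:E
                    * (frobenius (W j 1 - W j 0) ^+ 2)%:E))
   + sigma_min Sigma ^+ 2 * 2^-1%:E * (frobenius (Wlast 1 - Wlast 0) ^+ 2)%:E
   + (\sum_(j < k) (rho_min Sigma j ^+ 2 * 2^-1%:E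
                    * (frobenius (V j 1 - V j 0) ^+ 2)%:E))
   <= (frobenius dB ^+ 2)%:E)%E
  /\
  (m = n ->
   ((frobenius (Sing (B + dB) - Sing B) ^+ 2)%:E
    + (\sum_(j < k) (rho_min Sigma j ^+ 2 * 2^-1%:E
                     * (frobenius (W j 1 - W j 0) ^+ 2
                        + frobenius (V j 1 - V j 0) ^+ 2)%:E))
    <= (frobenius dB ^+ 2)%:E)%E).
Proof.
subst n.
have bound := integrated_bound (W := W) (Wlast := Wlast) (V := V)
  Sigma_analytic W_analytic V_analytic W_unitary V_unitary decomp W_derive Wlast_derive V_derive.
pose c j := fine (rho_min Sigma j).
have c0 j : 0 <= c j by rewrite fine_ge0 ?rho_min_ge0.
have cS (t : R) : 0 <= t <= 1 -> forall i j : 'I_k, i != j -> forall x y : R,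
    x \in singular_values (Sigma j t) -> y \in singular_values (Sigma i t) -> c j <= `|x - y|.
  move=> t01 i j ij x y xj yi; apply: fine_le_of_le (rho_min_le t01 ij xj yi).
  exact: rho_min_ge0.
have V1 j : rho_min Sigma j = +oo%E -> frob2 (V j 1 - V j 0) = 0.
  move=> /(rho_min_pinfty r_gt0) one.
  exact: (single_block_V (V := V) V_analytic V_unitary V_derive one).
split=> [|mn].
  pose a j := fine (rho_hat_min Sigma j); pose s := fine (sigma_min Sigma).
  have a0 j : 0 <= a j by rewrite fine_ge0 ?rho_hat_min_ge0.
  have aS (t : R) : 0 <= t <= 1 -> forall i j : 'I_k, i != j -> forall x y : R,
      x \in singular_values (Sigma j t) -> y \in singular_values (Sigma i t) -> a j <= `|x - y|.
    move=> t01 i j ij x y xj yi; apply: fine_le_of_le (rho_hat_min_le_rho t01 ij xj yi).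
    exact: rho_hat_min_ge0.
  have lS : (m - \sum_j r j)%N = 0%N \/ (0 <= s /\ forall t : R, 0 <= t <= 1 -> forall j x,
      x \in singular_values (Sigma j t) -> a j <= x /\ s <= x).
    right; split=> [|t t01 j x xj]; first by rewrite fine_ge0 ?sigma_min_ge0.
    split; first exact: fine_le_of_le (rho_hat_min_ge0 _ _) (rho_hat_min_le_sigma t01 xj).
    exact: fine_le_of_le (sigma_min_ge0 _) (sigma_min_le t01 xj).
  have bnd := bound a c s a0 c0 aS cS lS.
  rewrite !frobenius_sqr (weight_term (sigma_min_ge0 _)); last first.
    by move=> /(sigma_min_fin r_gt0 k_gt0).
  rewrite (eq_bigr (fun j => (2^-1 * a j ^+ 2 * frob2 (W j 1 - W j 0))%:E)); last first.
    move=> j _; rewrite frobenius_sqr weight_term ?rho_hat_min_ge0 //.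
    by move=> /(rho_hat_min_fin r_gt0).
  rewrite [X in (_ + X <= _)%E](eq_bigr (fun j =>
    (2^-1 * c j ^+ 2 * frob2 (V j 1 - V j 0))%:E)); last first.
    by move=> j _; rewrite frobenius_sqr weight_term ?rho_min_ge0 //; exact: V1.
  by rewrite !sumEFin -!EFinD lee_fin.
have mn0 : (m - \sum_j r j)%N = 0%N by rewrite mn subnn.
have W1 j : rho_min Sigma j = +oo%E -> frob2 (W j 1 - W j 0) = 0.
  move=> /(rho_min_pinfty r_gt0) one.
  exact: (single_block_W (W := W) (Wlast := Wlast) W_analytic W_unitary W_derive mn0 one).
have bnd := bound c c 0 c0 c0 cS cS (or_introl mn0).
rewrite !frobenius_sqr (eq_bigr (fun j => (2^-1 * c j ^+ 2 * frob2 (W j 1 - W j 0) +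
    2^-1 * c j ^+ 2 * frob2 (V j 1 - V j 0))%:E)); last first.
  move=> j _; rewrite !frobenius_sqr weight_term ?rho_min_ge0 // ?mulrDr // => roo.
  by rewrite W1 // V1 // addr0.
rewrite sumEFin -EFinD lee_fin big_split /= addrA; apply: le_trans bnd.
by rewrite expr0n mulr0 mul0r addr0.
Qed.
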